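(* Let $(M,L)$ and $(M,\widetilde L)$ be conformally related Finsler manifolds. Then $(M,L)$ is $S^{v}$-recurrent if and only if $(M,\widetilde{L})$ is $S^{v}$-recurrent.
   Context: $M$ is a real paracompact $C^\infty$ manifold of finite dimension $n$; all objects are $C^\infty$. $\pi:\mathcal{T}M\to M$ is the bundle of nonzero tangent vectors, $\pi^{-1}(TM)$ the pullback of $TM$ by $\pi$. Sections of $\pi^{-1}(TM)$ are called $\pi$-vector fields; $\pi$-forms are forms on $\pi^{-1}(TM)$; $\overline\eta(u)=(u,u)$. $\rho:T(\mathcal{T}M)\to\pi^{-1}(TM)$ is $\rho=(\pi_{\mathcal{T}M},d\pi)$ and $\gamma:\pi^{-1}(TM)\to T(\mathcal{T}M)$ is the vertical lift. For a linear connection $D$ on $\pi^{-1}(TM)$, $K(X):=D_X\overline\eta$; $D$ is regular if $T(\mathcal{T}M)=V(\mathcal{T}M)\oplus H(\mathcal{T}M)$ with $H=\ker K$, $V$ the vertical bundle, and then $\beta:=(\rho|_{H})^{-1}$. Torsion: $\mathbf{T}(X,Y)=D_X\rho Y-D_Y\rho X-\rho[X,Y]$, $Q(\overline X,\overline Y)=\mathbf{T}(\beta\overline X,\beta\overline Y)$, $T(\overline X,\overline Y)=\mathbf{T}(\gamma\overline X,\beta\overline Y)$. Curvature: $\mathbf{K}(X,Y)\rho Z=-D_XD_Y\rho Z+D_YD_X\rho Z+D_{[X,Y]}\rho Z$, v-curvature $S(\overline X,\overline Y)\overline Z=\mathbf{K}(\gamma\overline X,\gamma\overline Y)\overline Z$.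 $(M,L)$ is a Finsler manifold with Finsler metric $g$ on $\pi^{-1}(TM)$. The Cartan connection $\nabla$ is the unique regular connection with $\nabla g=0$, $Q=0$ and $g(T(\overline X,\overline Y),\overline Z)=g(T(\overline X,\overline Z),\overline Y)$; $S$ is its v-curvature. $(M,L)$ is $S^v$-recurrent if $(\nabla_{\gamma\overline X}S)(\overline Y,\overline Z,\overline W)=\lambda(\overline X)S(\overline Y,\overline Z)\overline W$ for all $\overline X,\overline Y,\overline Z,\overline W$, for some $\pi$-form $\lambda$ of order one. $(M,L)$ and $(M,\widetilde L)$ are conformally related if $\widetilde g=e^{2\sigma(x)}g$ for a positive differentiable function $\sigma$ on $M$. *)

(* Defs.v *)
From HB Require Import structures.
From mathcomp Require Import all_boot all_order all_algebra.
From mathcomp Require Import all_classical all_reals all_analysis.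

Set Implicit Arguments.
Unset Strict Implicit.
Unset Printing Implicit Defensive.

Import Order.TTheory GRing.Theory Num.Theory.
Import numFieldNormedType.Exports.

Local Open Scope classical_set_scope.
Local Open Scope ring_scope.

Section smooth_maps.
Context {R : realType} {E F : normedModType R}.

(* Used with U open: f is C^0 on U when it is continuous there, and C^(k+1)
   when it is Frechet differentiable there and all its directional
   derivatives are C^k. *)
Fixpoint Cn (k : nat) (U : set E) (f : E -> F) : Prop :=
  match k with
  | 0%N => forall a, U a -> {for a, continuous f}
  | k'.+1 => (forall a, U a -> differentiable f a) /\
             forall v : E, Cn k' U ('D_v f)
  end.

Definition Cinf (U : set E) (f : E -> F) := forall k, Cn k U f.

(* C^oo in a neighbourhood of a *)
Definition Cinf_near (f : E -> F) (a : E) :=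
  exists U : set E, [/\ open U, U a & Cinf U f].

End smooth_maps.

(* A family of local parametrizations (inverses of charts) of X by open sets
   of E. The map [par i] is only meaningful on [dom i]. *)
Record atlas {R : realType} (E : normedModType R) (X : Type) := Atlas {
  idx : Type;
  dom : idx -> set E;
  par : idx -> E -> X }.
Arguments idx {R E X} a.
Arguments dom {R E X} a i _.
Arguments par {R E X} a i _.

Section tangent_space.
Context {R : realType} {E : normedModType R} {X : Type} (A : atlas E X).

Definition smooth_at (x : X) (f : X -> R) :=
  forall i a, dom A i a -> par A i a = x -> Cinf_near (f \o par A i) a.

(* The derivation of germs at [par A i a] with components y in the chart i.
   Functionals are defined on all functions; they are set to 0 on those which
   are not smooth at the point, so that equality of tangent vectors is
   equality on germs of smooth functions. *)
Definition coord_vec (i : idx A) (a y : E) : (X -> R) -> R := fun f =>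
  if `[< smooth_at (par A i a) f >] then 'D_y (f \o par A i) a else 0.

(* v is a linear combination of the partial derivatives at x, in every chart *)
Definition is_tangent (x : X) (v : (X -> R) -> R) :=
  forall i a, dom A i a -> par A i a = x -> exists y : E, v = coord_vec i a y.

Definition tangent_pred (x : X) : {pred (X -> R) -> R} :=
  fun v => `[< is_tangent x v >].

Record tangent (x : X) := Tangent {
  tfun :> (X -> R) -> R;
  tfunP : tangent_pred x tfun }.

HB.instance Definition _ x := [isSub for @tfun x].
HB.instance Definition _ x := [Choice of tangent x by <:].

Lemma tangent_pred_closed x : submod_closed (tangent_pred x).
Proof.
split.
  apply/asboolP => i a da ax; exists 0; apply/funext => f.
  rewrite /coord_vec; case: asboolP => // sf.
  have [U [_ Ua /(_ 1)[/(_ a Ua) df _]]] := sf i a da erefl.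
  by rewrite deriveE // linear0.
move=> c v w /asboolP hv /asboolP hw; apply/asboolP => i a da ax.
have [y ->] := hv i a da ax; have [z ->] := hw i a da ax.
exists (c *: y + z); apply/funext => f.
rewrite /= !fctE /coord_vec; case: asboolP => [sf|_]; last by rewrite scaler0 addr0.
have [U [_ Ua /(_ 1)[/(_ a Ua) df _]]] := sf i a da erefl.
by rewrite !deriveE // linearP.
Qed.
HB.instance Definition _ x :=
  GRing.isSubmodClosed.Build R ((X -> R) -> R) (tangent_pred x)
    (tangent_pred_closed x).
HB.instance Definition _ x := [SubChoice_isSubLmodule of tangent x by <:].

(* The tangent vector at x acting as w on germs of smooth functions; it is
   0 when w does not act as a tangent vector, which never happens for the
   smooth objects to which this is applied. *)
Definition tvec (x : X) (w : (X -> R) -> R) : tangent x :=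
  insubd 0 (fun f => if `[< smooth_at x f >] then w f else 0).

End tangent_space.

Definition paracompact (T : topologicalType) := forall C : set (set T),
  (forall V, C V -> open V) -> \bigcup_(V in C) V = setT ->
  exists B : set (set T), [/\ forall V, B V -> open V,
    \bigcup_(V in B) V = setT,
    forall V, B V -> exists2 W, C W & V `<=` W &
    forall x : T, exists2 N, nbhs x N &
      finite_set [set V | B V /\ V `&` N !=set0]].

(* The last condition says that the change of coordinates from i to j,
   defined where the images of both parametrizations meet, is C^oo. *)
Record smooth_manifold {R : realType} {n : nat} {M : topologicalType}
    (A : atlas 'rV[R]_n M) : Prop := SmoothManifold {
  mfd_hausdorff : hausdorff_space M;
  mfd_paracompact : paracompact M;
  mfd_cover : forall x, exists i a, dom A i a /\ par A i a = x;
  mfd_dom_open : forall i, open (dom A i);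
  mfd_par_inj : forall i, {in dom A i &, injective (par A i)};
  mfd_par_continuous : forall i a, dom A i a -> {for a, continuous (par A i)};
  mfd_par_open : forall i U, open U -> U `<=` dom A i -> open (par A i @` U);
  mfd_transition : forall i j, exists h : 'rV[R]_n -> 'rV[R]_n,
    let W := [set a | dom A i a /\ (par A j @` dom A j) (par A i a)] in
    (forall a, W a -> dom A j (h a) /\ par A j (h a) = par A i a) /\
    Cinf W h }.

Arguments mfd_dom_open {R n M A} _ _.
Arguments mfd_par_inj {R n M A} _ _.
Arguments mfd_par_continuous {R n M A} _ _ _ _.
Arguments mfd_par_open {R n M A} _ _ _ _ _.

Lemma near_derive_eq {R : realType} {E F : normedModType R} (f g : E -> F) a v :
  differentiable f a -> (\forall b \near a, f b = g b) -> 'D_v f a = 'D_v g a.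
Proof.
move=> df fg.
have cf : derivable f a v by exact: diff_derivable.
apply/esym/(cvg_lim (@norm_hausdorff _ _)).
apply: cvg_trans cf; apply: near_eq_cvg.
have fga : f a = g a by exact: nbhs_singleton fg.
have : (fun h : R => h *: v + a) @ 0 --> (0 *: v + a).
  by apply: cvgD; [apply: cvgZr_tmp; exact: cvg_id|exact: cvg_cst].
rewrite scale0r add0r => /(_ _ fg) /= H.
apply: cvg_within.
near=> h => /=; rewrite fga; congr (_ *: (_ - _)).
by near: h.
Unshelve. all: by end_near. Qed.

Lemma coord_vec_tangent {R : realType} {n : nat} {M : topologicalType}
    (A : atlas 'rV[R]_n M) i (a y : 'rV[R]_n) :
  smooth_manifold A -> dom A i a ->
  is_tangent A (par A i a) (coord_vec i a y).
Proof.
move=> hA da j b db ba.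
have [h [hW Ch]] := mfd_transition hA i j.
set W := (X in Cinf X h) in Ch; have Wa : W a by split=> //; exists b.
have [dha pha] := hW a Wa.
have inj := mfd_par_inj hA j.
have hab : h a = b.
  apply: inj; [exact: mem_set|exact: mem_set|by rewrite pha ba].
have [dh _] := Ch 1%N.
exists ('D_y h a); apply/funext => f; rewrite /coord_vec ba.
case: asboolP => // sf.
have [U [_ Ub /(_ 1)[/(_ b Ub) df _]]] := sf j b db ba.
have [V [_ Va /(_ 1)[/(_ a Va) dfi _]]] := sf i a da erefl.
have dha' := dh a Wa; rewrite -hab in df.

have E : \forall c \near a, (f \o par A i) c = ((f \o par A j) \o h) c.
  have oj := mfd_par_open hA j _ (mfd_dom_open hA j) (@subset_refl _ _).
  have nW : nbhs a (par A i @^-1` (par A j @` dom A j)).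
    apply: (mfd_par_continuous hA i a da).
    by apply: open_nbhs_nbhs; split=> //; exists b.
  have ni : nbhs a (dom A i).
    by apply: open_nbhs_nbhs; split=> //; exact: mfd_dom_open hA i.
  near=> c; rewrite /=; have [|_ ->//] := hW c; split; by near: c.
rewrite (near_derive_eq y dfi E).
rewrite (deriveE y dha') (deriveE y (differentiable_comp dha' df)).
rewrite (diff_comp dha' df).
by rewrite -hab (deriveE _ df).
Unshelve. all: by end_near. Qed.

Lemma tvec_coord_vec {R : realType} {n : nat} {M : topologicalType}
    (A : atlas 'rV[R]_n M) i (a y : 'rV[R]_n) :
  smooth_manifold A -> dom A i a ->
  tvec A (par A i a) (coord_vec i a y) = coord_vec i a y :> ((M -> R) -> R).
Proof.
move=> hA da; rewrite /tvec.
have -> : (fun f => if `[< smooth_at A (par A i a) f >]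
    then coord_vec i a y f else 0) = coord_vec (A := A) i a y.
  by apply/funext => f; rewrite /coord_vec; case: asboolP.
have/asboolP h := coord_vec_tangent y hA da.
by rewrite insubdK.
Qed.

Section tangent_bundle.
Context {R : realType} {n : nat} {M : topologicalType} (A : atlas 'rV[R]_n M).

Definition TM := {x : M & tangent A x}.
Definition base (u : TM) : M := projT1 u.
Definition fibre (u : TM) : tangent A (base u) := projT2 u.

(* the nonzero tangent vectors *)
Definition slit (u : TM) := fibre u != 0.

Definition tm_atlas : atlas ('rV[R]_n * 'rV[R]_n)%type TM := {|
  idx := idx A;
  dom := fun i => [set p | dom A i p.1];
  par := fun i p =>
    existT _ (par A i p.1) (tvec A (par A i p.1) (coord_vec i p.1 p.2)) |}.

(* Everything below lives over the open set of nonzero vectors; objects are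
   total on TM and their values at zero vectors are irrelevant. *)
Definition smooth_fun (F : TM -> R) :=
  forall u, slit u -> smooth_at tm_atlas u F.

Definition field := forall u : TM, tangent tm_atlas u.
Definition pi_field := forall u : TM, tangent A (base u).

Definition field_smooth_at (u : TM) (X : field) :=
  forall i p, dom tm_atlas i p -> par tm_atlas i p = u ->
    exists2 xi : 'rV[R]_n * 'rV[R]_n -> 'rV[R]_n * 'rV[R]_n, Cinf_near xi p &
      \forall q \near p,
        tfun (X (par tm_atlas i q)) = coord_vec (A := tm_atlas) i q (xi q).

Definition pi_smooth (Y : pi_field) := forall u, slit u ->
  forall i p, dom tm_atlas i p -> par tm_atlas i p = u ->
    exists2 eta : 'rV[R]_n * 'rV[R]_n -> 'rV[R]_n, Cinf_near eta p &
      \forall q \near p,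
        tfun (Y (par tm_atlas i q)) = coord_vec (A := A) i q.1 (eta q).

Definition eta_bar : pi_field := fibre.

(* dpi, as the push-forward of functionals on functions *)
Definition rho (u : TM) (w : (TM -> R) -> R) : tangent A (base u) :=
  tvec A (base u) (fun f => w (f \o base)).

Definition add_fibre (u : TM) (v : tangent A (base u)) : TM :=
  existT _ (base u) (fibre u + v).

Definition gamma (u : TM) (v : tangent A (base u)) : tangent tm_atlas u :=
  tvec tm_atlas u (fun F => derive1 (fun t : R => F (add_fibre (t *: v))) 0).

Definition gammaf (Y : pi_field) : field := fun u => gamma (Y u).

Definition bracket (X Y : field) (u : TM) : (TM -> R) -> R :=
  fun F => X u (fun v => Y v F) - Y u (fun v => X v F).

Definition bracketf (X Y : field) : field :=
  fun u => tvec tm_atlas u (bracket X Y u).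

(* [D u w Y] is the derivative at u of the section Y in the direction w *)
Definition connection :=
  forall u : TM, tangent tm_atlas u -> pi_field -> tangent A (base u).

Record is_connection (D : connection) : Prop := IsConnection {
  conn_linear : forall u Y, slit u -> pi_smooth Y ->
    linear (fun w => D u w Y);
  conn_add : forall u w Y Z, slit u -> pi_smooth Y -> pi_smooth Z ->
    D u w (fun v => Y v + Z v) = D u w Y + D u w Z;
  conn_leibniz : forall u w F Y, slit u -> smooth_fun F -> pi_smooth Y ->
    D u w (fun v => F v *: Y v) = w F *: Y u + F u *: D u w Y;
  conn_smooth : forall X Y, (forall u, slit u -> field_smooth_at u X) ->
    pi_smooth Y -> pi_smooth (fun u => D u (X u) Y) }.

Section along_connection.
Variable D : connection.
Arguments D : clear implicits.

Definition cov (X : field) (Y : pi_field) : pi_field := fun u => D u (X u) Y.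

Definition Kmap (u : TM) (w : tangent tm_atlas u) : tangent A (base u) :=
  D u w eta_bar.

Definition vertical (u : TM) (w : tangent tm_atlas u) := rho u w = 0.
Definition horizontal (u : TM) (w : tangent tm_atlas u) := Kmap w = 0.

(* T_u(TM) is the direct sum of the vertical and horizontal spaces *)
Definition regular := forall u, slit u ->
  (forall w : tangent tm_atlas u, vertical w -> horizontal w -> w = 0) /\
  (forall w : tangent tm_atlas u, exists v h,
     [/\ vertical v, horizontal h & w = v + h]).

(* the inverse of rho on horizontal vectors *)
Definition beta (u : TM) (v : tangent A (base u)) : tangent tm_atlas u :=
  xget 0 [set h : tangent tm_atlas u | horizontal h /\ rho u h = v].

Definition betaf (Y : pi_field) : field := fun u => beta (Y u).

Definition rhof (X : field) : pi_field := fun u => rho u (X u).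

Definition torsion (X Y : field) : pi_field := fun u =>
  cov X (rhof Y) u - cov Y (rhof X) u - rho u (bracket X Y u).

Definition torsionQ (X Y : pi_field) : pi_field := torsion (betaf X) (betaf Y).
Definition torsionT (X Y : pi_field) : pi_field := torsion (gammaf X) (betaf Y).

Definition curvature (X Y : field) (Z : pi_field) : pi_field := fun u =>
  - cov X (cov Y Z) u + cov Y (cov X Z) u + cov (bracketf X Y) Z u.

Definition v_curvature (X Y Z : pi_field) : pi_field :=
  curvature (gammaf X) (gammaf Y) Z.

Definition cov_v_curvature (X Y Z W : pi_field) : pi_field := fun u =>
  let DX := cov (gammaf X) in
  DX (v_curvature Y Z W) u - v_curvature (DX Y) Z W u
  - v_curvature Y (DX Z) W u - v_curvature Y Z (DX W) u.

End along_connection.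

Record is_pi_one_form (lambda : forall u : TM, tangent A (base u) -> R) : Prop :=
  IsPiOneForm {
    form_linear : forall u, slit u -> scalar (lambda u);
    form_smooth : forall Y, pi_smooth Y -> smooth_fun (fun u => lambda u (Y u)) }.

(* half the second derivative of L^2 along the fibre *)
Definition finsler_metric (L : TM -> R) (u : TM) (v w : tangent A (base u)) : R :=
  2^-1 * derive1 (fun s : R =>
    derive1 (fun t : R => L (add_fibre (s *: v + t *: w)) ^+ 2) 0) 0.

Record is_finsler (L : TM -> R) : Prop := IsFinsler {
  finsler_zero : forall u, fibre u = 0 -> L u = 0;
  finsler_pos : forall u, slit u -> 0 < L u;
  finsler_continuous : forall i p, dom tm_atlas i p ->
    {for p, continuous (L \o par tm_atlas i)};
  finsler_smooth : smooth_fun L;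
  finsler_homogeneous : forall (c : R) u, 0 < c ->
    L (existT _ (base u) (c *: fibre u)) = c * L u;
  finsler_definite : forall u (v : tangent A (base u)), slit u -> v != 0 ->
    0 < finsler_metric L v v }.

Definition metric_fun (L : TM -> R) (Y Z : pi_field) : TM -> R :=
  fun u => finsler_metric L (Y u) (Z u).

Record is_cartan (L : TM -> R) (D : connection) : Prop := IsCartan {
  cartan_connection : is_connection D;
  cartan_regular : regular D;
  cartan_metric : forall u (w : tangent tm_atlas u) Y Z,
    slit u -> pi_smooth Y -> pi_smooth Z ->
    w (metric_fun L Y Z) =
      finsler_metric L (D u w Y) (Z u) + finsler_metric L (Y u) (D u w Z);
  cartan_Q : forall X Y u, pi_smooth X -> pi_smooth Y -> slit u ->
    torsionQ D X Y u = 0;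
  cartan_T : forall X Y Z u, pi_smooth X -> pi_smooth Y -> pi_smooth Z ->
    slit u ->
    finsler_metric L (torsionT D X Y u) (Z u) =
      finsler_metric L (torsionT D X Z u) (Y u) }.

(* Sv-recurrence of a Finsler manifold, D being its Cartan connection *)
Definition Sv_recurrent (D : connection) :=
  exists2 lambda, is_pi_one_form lambda &
    forall X Y Z W u, pi_smooth X -> pi_smooth Y -> pi_smooth Z ->
      pi_smooth W -> slit u ->
      cov_v_curvature D X Y Z W u = lambda u (X u) *: v_curvature D Y Z W u.

Definition conformal (L L' : TM -> R) := exists sigma : M -> R,
  [/\ forall x, smooth_at A x sigma,
      forall x, 0 < sigma x &
      forall u (v w : tangent A (base u)), slit u ->
        finsler_metric L' v w =
          expR (2 * sigma (base u)) * finsler_metric L v w].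

End tangent_bundle.

(* Main.v *)
(* The vertical part of the Cartan connection only depends on the fibrewise
   metric: for a second metric g' = e^(2 sigma) g, put
   B Y = nabla_(gamma X) Y - nabla'_(gamma X) Y.  Since the mixed torsion T
   differs from nabla_(gamma X) Y by rho [gamma X, beta Y], a term not depending
   on the connection, and since gamma X kills sigma, metricity gives
   g (B Y, Z) + g (Y, B Z) = 0 while the symmetry of T gives
   g (B Y, Z) = g (B Z, Y).  Taking (B Y, Y) for (Y, Z) in the first identity
   and Z = B Y in the second yields 2 g (B Y, B Y) = 0, hence B = 0.

   The v-curvature and its vertical covariant derivatives only involve
   derivatives in vertical directions, because [gamma X, gamma Y] is again
   gamma of a smooth pi-vector field; they are therefore the same for both
   connections, and the recurrence conditions coincide with the same form. *)
Require Import Defs.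
From HB Require Import structures.
From mathcomp Require Import all_boot all_order all_algebra.
From mathcomp Require Import all_classical all_reals all_analysis.

Set Implicit Arguments.
Unset Strict Implicit.
Unset Printing Implicit Defensive.

Import Order.TTheory GRing.Theory Num.Theory.
Import numFieldNormedType.Exports.

Local Open Scope classical_set_scope.
Local Open Scope ring_scope.

(** * Maps of class C^k *)

(** Two conventions shape the work. Sections and functions are total on [TM], while every hypothesis
    concerns nonzero vectors, so sections that ought to be equal may differ on the zero section.
    Connections, brackets and curvatures are therefore shown to depend only on values over the slit
    bundle, and the comparison lemmas carry pairs of arguments that agree there. Moreover, a tangent
    vector is a functional sending non-smooth functions to 0: each evaluation needs either a proof
    of smoothness or a check that both sides take this default. The analytic core is that the
    bracket of vertical fields is of first order, which rests on the symmetry of second derivatives.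
    As [Cn] only controls derivatives along fixed vectors, derivatives along moving directions are
    first expanded in a finite frame. *)

Section Cn_theory.
Context {R : realType}.
Implicit Types E F G : normedModType R.

Lemma Cn_subset E F k (U V : set E) (f : E -> F) :
  V `<=` U -> Cn k U f -> Cn k V f.
Proof.
elim: k f => [|k IH] f VU /=; first by move=> h a /VU/h.
by move=> [df Df]; split=> [a /VU/df//|v]; exact: IH (Df v).
Qed.

Lemma near_open E (U : set E) (a : E) (P : E -> Prop) :
  open U -> U a -> (forall b, U b -> P b) -> \forall b \near a, P b.
Proof. by move=> oU Ua UP; apply: (filterS UP); exact: open_nbhs_nbhs. Qed.

(** The remainder in the definition of the differential depends only on the germ at [a], so ['d f a]
    serves for [g] as well. *)
Lemma near_eq_differentiable E F (f g : E -> F) a :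
  (\forall b \near a, f b = g b) -> differentiable f a -> differentiable g a.
Proof.
move=> fg df.
have fg0 : \forall b \near 0, f (b + a) = g (b + a).
  have : (fun b : E => b + a) @ 0 --> 0 + a.
    by apply: cvgD; [exact: cvg_id|exact: cvg_cst].
  by rewrite add0r => /(_ _ fg).
have fga : f a = g a by exact: nbhs_singleton fg.
have cd : continuous ('d f a) by exact: diff_continuous.
have E1 : g \o shift a = cst (g a) + 'd f a +o_ 0 id.
  apply/eqaddoP => e e0; have /eqaddoP/(_ e e0) := diff_locally df.
  by move=> fo; near=> b; rewrite -fga /= !fctE /= -(near fg0 b)//; near: b.
by apply/diff_locallyP; rewrite (diff_unique cd E1).
Unshelve. all: by end_near. Qed.

Lemma Cn_ext E F k (U : set E) (f g : E -> F) : open U ->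
  (forall a, U a -> f a = g a) -> Cn k U f -> Cn k U g.
Proof.
move=> oU; elim: k f g => [|k IH] f g fg /=.
  move=> cf a Ua; have cfa := cf a Ua.
  change (g x @[x --> a] --> g a); rewrite -(fg a Ua).
  apply: cvg_trans cfa; apply: near_eq_cvg.
  exact: (near_open oU Ua) fg.
move=> [df Df]; split=> [a Ua|v].
  by apply: near_eq_differentiable (df a Ua); exact: (near_open oU Ua) fg.
apply: (IH ('D_v f)) (Df v) => a Ua.
by apply: near_eq_derive; exact: (near_open oU Ua) fg.
Qed.

Lemma CnS E F k (U : set E) (f : E -> F) : Cn k.+1 U f -> Cn k U f.
Proof.
elim: k f => [|k IH] f [df Df] /=.
  by move=> a Ua; apply: differentiable_continuous; exact: df.
by split=> // v; apply: IH; exact: Df.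
Qed.

Lemma Cn_cst E F k (U : set E) (c : F) : Cn k U (cst c : E -> F).
Proof.
elim: k c => [|k IH] c /=; first by move=> a _; exact: cst_continuous.
split=> // v.
have -> : 'D_v (cst c : E -> F) = cst 0 by apply/funext => a; exact: derive_cst.
exact: IH.
Qed.

Lemma Cn_add E F k (U : set E) (f g : E -> F) : open U ->
  Cn k U f -> Cn k U g -> Cn k U (fun a => f a + g a).
Proof.
move=> oU; elim: k f g => [|k IH] f g /=.
  by move=> cf cg a Ua; apply: continuousD; [exact: cf|exact: cg].
move=> [df Df] [dg Dg]; split=> [a Ua|v].
  by apply: differentiableD; [exact: df|exact: dg].
apply: Cn_ext (IH _ _ (Df v) (Dg v)) => // a Ua.
by rewrite deriveD//; apply: diff_derivable; [exact: df|exact: dg].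
Qed.

Lemma Cn_sum E F (I : Type) (s : seq I) k (U : set E) (f : I -> E -> F) :
  open U -> (forall i, Cn k U (f i)) -> Cn k U (fun a => \sum_(i <- s) f i a).
Proof.
move=> oU hf; elim: s => [|i s IH].
  by apply: Cn_ext (Cn_cst k U 0) => // a _; rewrite big_nil.
by apply: Cn_ext (Cn_add oU (hf i) IH) => // a _; rewrite big_cons.
Qed.

Lemma Cn_mul E k (U : set E) (f g : E -> R) : open U ->
  Cn k U f -> Cn k U g -> Cn k U (fun a => f a * g a).
Proof.
move=> oU; elim: k f g => [|k IH] f g.
  by move=> cf cg a Ua; apply: continuousM; [exact: cf|exact: cg].
move=> Cf Cg; have [df Df] := Cf; have [dg Dg] := Cg; split=> [a Ua|v].
  by apply: differentiableM; [exact: df|exact: dg].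
have := Cn_add oU (IH _ _ (CnS Cf) (Dg v)) (IH _ _ (CnS Cg) (Df v)).
apply: Cn_ext => // a Ua.
by rewrite deriveM//; apply: diff_derivable; [exact: df|exact: dg].
Qed.

Lemma derive_linear_comp E F G (l : {linear F -> G}) (f : E -> F) a v :
  continuous l -> differentiable f a -> 'D_v (l \o f) a = l ('D_v f a).
Proof.
move=> cl df; have dl := linear_differentiable (f a) cl.
rewrite deriveE; last exact: differentiable_comp.
by rewrite diff_comp// diff_lin//= deriveE.
Qed.

Lemma Cn_linear_comp E F G (l : {linear F -> G}) k (U : set E) (f : E -> F) :
  continuous l -> open U -> Cn k U f -> Cn k U (l \o f).
Proof.
move=> cl oU; elim: k f => [|k IH] f /=.
  by move=> cf a Ua; apply: continuous_comp; [exact: cf|exact: cl].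
move=> [df Df]; split=> [a Ua|v].
  by apply: differentiable_comp; [exact: df|exact: linear_differentiable].
apply: Cn_ext (IH _ (Df v)) => // a Ua.
by rewrite derive_linear_comp//; exact: df.
Qed.

(** Valid for arbitrary [f]: by linearity of [l] both sides are limits of the same difference
    quotient. *)
Lemma derive_comp_linear E F G (l : {linear E -> F}) (f : F -> G) a v :
  'D_v (f \o l) a = 'D_(l v) f (l a).
Proof.
rewrite /derive; apply: (congr1 (fun h : R -> G => lim (h @ 0^'))).
by apply/funext => h /=; rewrite linearP.
Qed.

Lemma Cn_comp_linear E F G (l : {linear E -> F}) k (U : set F) (f : F -> G) :
  continuous l -> Cn k U f -> Cn k (l @^-1` U) (f \o l).
Proof.
move=> cl; elim: k f => [|k IH] f /=.
  by move=> cf a Ua; apply: continuous_comp; [exact: cl|exact: cf].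
move=> [df Df]; split=> [a Ua|v].
  by apply: differentiable_comp; [exact: linear_differentiable|exact: df].
have -> : 'D_v (f \o l) = 'D_(l v) f \o l.
  by apply/funext => a; exact: derive_comp_linear.
exact: IH.
Qed.

Lemma Cn_linear E F (l : {linear E -> F}) k (U : set E) :
  continuous l -> Cn k U l.
Proof.
move=> cl; case: k => [|k] /=; first by move=> a _; exact: cl.
split=> [a _|v]; first exact: linear_differentiable.
have -> : 'D_v l = cst (l v).
  by apply/funext => a; rewrite deriveE ?diff_lin//; exact: linear_differentiable.
exact: Cn_cst.
Qed.

Lemma derive_expR_comp E (f : E -> R) a v : differentiable f a ->
  differentiable (fun b => expR (f b)) a /\
  'D_v (fun b => expR (f b)) a = expR (f a) * 'D_v f a.
Proof.
move=> df; have de : differentiable (@expR R) (f a).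
  by apply/derivable1_diffP; exact: derivable_expR.
have dc : differentiable (expR \o f) a by exact: differentiable_comp.
split=> //; change ('D_v (expR \o f) a = expR (f a) * 'D_v f a).
rewrite deriveE// diff_comp//= -(deriveE v df).
have eE : (@expR R)^`()%classic (f a) = expR (f a) 
  by rewrite derive1E (@derive_val _ _ _ _ _ _ _ (is_derive_expR (f a))).
by rewrite diff1E//= eE mulrC.
Qed.

Lemma Cn_expR E k (U : set E) (f : E -> R) : open U ->
  Cn k U f -> Cn k U (fun a => expR (f a)).
Proof.
move=> oU; elim: k f => [|k IH] f.
  by move=> cf a Ua; apply: continuous_comp; [exact: cf|exact: continuous_expR].
move=> Cf; have [df Df] := Cf; split=> [a Ua|v].
  by have [] := derive_expR_comp 0 (df a Ua).
apply: Cn_ext (Cn_mul oU (IH _ (CnS Cf)) (Df v)) => // a Ua.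
by have [_ ->] := derive_expR_comp v (df a Ua).
Qed.

End Cn_theory.

(** Finite dimension in the form used here: a derivative along a variable direction becomes a finite
    sum of derivatives along fixed vectors, with continuous linear coordinates as coefficients. *)
Record frame {R : realType} (F : normedModType R) := Frame {
  frame_idx : finType;
  frame_vec : frame_idx -> F;
  frame_coord : frame_idx -> {linear F -> R};
  frame_coord_continuous : forall i, continuous (frame_coord i);
  frame_expand : forall x, x = \sum_i frame_coord i x *: frame_vec i }.

Arguments frame_coord {R F} f i.

Section linear_maps.
Context {R : realType}.

(** Scaling of a fixed vector, entries, projections and injections receive names so that each
    carries a canonical linear structure, as the composition lemmas for [Cn] require. *)
Definition scale_by {F : normedModType R} (e : F) (r : R) : F := r *: e.
Lemma scale_by_linear (F : normedModType R) (e : F) : linear (scale_by e).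
Proof. by move=> k x y; rewrite /scale_by scalerDl scalerA. Qed.
HB.instance Definition _ (F : normedModType R) (e : F) :=
  GRing.isLinear.Build R R F _ (scale_by e) (scale_by_linear e).
Lemma scale_by_continuous (F : normedModType R) (e : F) :
  continuous (scale_by e).
Proof. exact: scalel_continuous. Qed.

Definition entry {n} (i : 'I_n) (x : 'rV[R]_n) : R := x ord0 i.
Lemma entry_linear n (i : 'I_n) : linear (entry i).
Proof. by move=> k x y; rewrite /entry !mxE. Qed.
HB.instance Definition _ n (i : 'I_n) :=
  GRing.isLinear.Build R 'rV[R]_n R _ (entry i) (entry_linear i).
Lemma entry_continuous n (i : 'I_n) : continuous (entry i).
Proof. exact: coord_continuous. Qed.

Definition prl {E F : normedModType R} (x : E * F) : E := x.1.
Lemma prl_linear (E F : normedModType R) : linear (@prl E F).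
Proof. by []. Qed.
HB.instance Definition _ (E F : normedModType R) :=
  GRing.isLinear.Build R (E * F)%type E _ (@prl E F) (@prl_linear E F).
Lemma prl_continuous (E F : normedModType R) : continuous (@prl E F).
Proof. by move=> x; exact: cvg_fst. Qed.

Definition prr {E F : normedModType R} (x : E * F) : F := x.2.
Lemma prr_linear (E F : normedModType R) : linear (@prr E F).
Proof. by []. Qed.
HB.instance Definition _ (E F : normedModType R) :=
  GRing.isLinear.Build R (E * F)%type F _ (@prr E F) (@prr_linear E F).
Lemma prr_continuous (E F : normedModType R) : continuous (@prr E F).
Proof. by move=> x; exact: cvg_snd. Qed.

Definition inl0 {E F : normedModType R} (x : E) : E * F := (x, 0).
Lemma inl0_linear (E F : normedModType R) : linear (@inl0 E F).
Proof. by move=> k x y; congr pair; rewrite /= scaler0 addr0. Qed.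
HB.instance Definition _ (E F : normedModType R) :=
  GRing.isLinear.Build R E (E * F)%type _ (@inl0 E F) (@inl0_linear E F).
Lemma inl0_continuous (E F : normedModType R) : continuous (@inl0 E F).
Proof. by move=> x; apply: cvg_pair; [exact: cvg_id|exact: cvg_cst]. Qed.

Definition inr0 {E F : normedModType R} (x : F) : E * F := (0, x).
Lemma inr0_linear (E F : normedModType R) : linear (@inr0 E F).
Proof. by move=> k x y; congr pair; rewrite /= scaler0 addr0. Qed.
HB.instance Definition _ (E F : normedModType R) :=
  GRing.isLinear.Build R F (E * F)%type _ (@inr0 E F) (@inr0_linear E F).
Lemma inr0_continuous (E F : normedModType R) : continuous (@inr0 E F).
Proof. by move=> x; apply: cvg_pair; [exact: cvg_cst|exact: cvg_id]. Qed.

End linear_maps.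

Section frames.
Context {R : realType}.

Lemma rV_expand n (x : 'rV[R]_n) :
  x = \sum_i entry i x *: (delta_mx 0 i : 'rV[R]_n).
Proof. exact: row_sum_delta. Qed.

Definition rV_frame n : frame 'rV[R]_n :=
  @Frame R 'rV[R]_n 'I_n (fun i => delta_mx 0 i) (fun i => @entry R n i)
    (@entry_continuous R n) (@rV_expand n).

Variables (E F : normedModType R) (fE : frame E) (fF : frame F).

Definition prod_vec (i : frame_idx fE + frame_idx fF) : E * F :=
  match i with
  | inl i => inl0 (frame_vec i)
  | inr i => inr0 (frame_vec i)
  end.

Definition prod_coord (i : frame_idx fE + frame_idx fF) :
    {linear (E * F)%type -> R} :=
  match i with
  | inl i => frame_coord fE i \o prl
  | inr i => frame_coord fF i \o prr
  end.

Lemma prod_coord_continuous i : continuous (prod_coord i).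
Proof.
case: i => i x; apply: continuous_comp.
- exact: prl_continuous.
- exact: frame_coord_continuous.
- exact: prr_continuous.
- exact: frame_coord_continuous.
Qed.

Lemma prod_expand x : x = \sum_i prod_coord i x *: prod_vec i.
Proof.
rewrite big_sumType/=; case: x => x y /=.
under eq_bigr do rewrite -linearZ.
under [in X in _ + X]eq_bigr do rewrite -linearZ.
rewrite -!linear_sum -!frame_expand.
by congr pair; rewrite /= ?addr0 ?add0r.
Qed.

Definition prod_frame : frame (E * F)%type :=
  Frame prod_coord_continuous prod_expand.

End frames.

(** * Chain rule in a frame and symmetry of second derivatives *)

Section directional_derivatives.
Context {R : realType}.
Implicit Types E F G : normedModType R.

Lemma derive_frame F G (b : frame F) (g : F -> G) a y : differentiable g a ->
  'D_y g a = \sum_i frame_coord b i y *: 'D_(frame_vec i) g a.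
Proof.
move=> dg; rewrite deriveE// {1}(frame_expand b y) linear_sum.
by apply: eq_bigr => i _; rewrite linearZ deriveE.
Qed.

Lemma Cn_frame E F (b : frame F) k (U : set E) (f : E -> F) : open U ->
  (forall i, Cn k U (frame_coord b i \o f)) -> Cn k U f.
Proof.
move=> oU hf; have hs i : Cn k U (scale_by (frame_vec i) \o (frame_coord b i \o f)).
  by apply: Cn_linear_comp => //; exact: scale_by_continuous.
by apply: Cn_ext (Cn_sum _ oU hs) => // a _; rewrite [RHS](frame_expand b).
Qed.

(** The induction closes because the chain rule, expanded in the frame, is a sum of products of a
    coordinate of ['D_v f] with a partial derivative of [g] composed with [f], and the latter is
    again a composition, one class lower. *)
Lemma Cn_comp E F (b : frame F) k (U : set E) (V : set F) (f : E -> F)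
    (g : F -> R) : open U -> open V -> (forall a, U a -> V (f a)) ->
  Cn k U f -> Cn k V g -> Cn k U (g \o f).
Proof.
move=> oU oV UV; elim: k g => [|k IH] g.
  by move=> cf cg a Ua; apply: continuous_comp; [exact: cf|exact: (cg _ (UV _ Ua))].
move=> Cf Cg; have [df Df] := Cf; have [dg Dg] := Cg; split=> [a Ua|v].
  by apply: differentiable_comp; [exact: df|exact: (dg _ (UV _ Ua))].
have hs i : Cn k U (fun a =>
    (frame_coord b i \o 'D_v f) a * ('D_(frame_vec i) g \o f) a).
  apply: Cn_mul => //; last exact: IH (CnS Cf) (Dg _).
  by apply: (Cn_linear_comp _ oU (Df v)); exact: frame_coord_continuous.
apply: Cn_ext (Cn_sum _ oU hs) => // a Ua /=.
have dfa := df a Ua; have dga := dg _ (UV _ Ua).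
rewrite [RHS]deriveE; last exact: differentiable_comp.
by rewrite (diff_comp dfa dga)/= -(deriveE v dfa) -deriveE// (derive_frame b _ dga).
Qed.

Lemma Cn_derive_along E F (b : frame F) k (U : set E) (V : set F)
    (f eta : E -> F) (g : F -> R) :
  open U -> open V -> (forall a, U a -> V (f a)) ->
  Cn k U f -> Cn k U eta -> Cn k.+1 V g ->
  Cn k U (fun a => 'D_(eta a) g (f a)).
Proof.
move=> oU oV UV Cf Ce [dg Dg].
have hs i : Cn k U (fun a =>
    (frame_coord b i \o eta) a * ('D_(frame_vec i) g \o f) a).
  apply: Cn_mul => //; last exact: (Cn_comp b oU oV UV Cf (Dg _)).
  by apply: (Cn_linear_comp _ oU Ce); exact: frame_coord_continuous.
apply: Cn_ext (Cn_sum _ oU hs) => // a Ua /=.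
by rewrite (derive_frame b _ (dg _ (UV _ Ua))).
Qed.

Lemma is_derive_line E (g : E -> R) p v (s : R) :
  differentiable g (p + s *: v) ->
  is_derive s 1 (fun s => g (p + s *: v)) ('D_v g (p + s *: v)).
Proof.
move=> dg; have dv := diff_derivable (v := v) dg.
have e : (fun h : R => h^-1 *: (((fun s => g (p + s *: v)) \o shift s) (h *: 1)
      - g (p + s *: v))) =
    (fun h => h^-1 *: ((g \o shift (p + s *: v)) (h *: v) - g (p + s *: v))).
  apply/funext => h /=; congr (_ *: (g _ - _)).
  by rewrite scalerDl addrCA [h *: 1]mulr1.
by apply: DeriveDef; [rewrite /derivable e|rewrite /derive e].
Qed.

(** The mean value theorem is applied twice: along [v] to the increment of [g] under the shift by
    [h *: w], then along [w] to ['D_v g]. Each application contributes one factor [h]. *)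
Lemma second_difference E (U : set E) (g : E -> R) p v w (h : R) :
  0 < h -> Cn 2 U g ->
  (forall s t, 0 <= s <= h -> 0 <= t <= h -> U (p + s *: v + t *: w)) ->
  exists s t, [/\ 0 <= s <= h, 0 <= t <= h &
    g (p + h *: v + h *: w) - g (p + h *: v) - g (p + h *: w) + g p =
    'D_w ('D_v g) (p + s *: v + t *: w) * h ^+ 2].
Proof.
move=> h0 [dg Dg] Uh; have [dDg _] := Dg v.
have hh : 0 <= h <= h by rewrite ltW//=.
have h00 : (0 : R) <= 0 <= h by rewrite lexx/= ltW.
pose psi (s : R) := g (p + h *: w + s *: v) - g (p + s *: v).
pose dpsi s := 'D_v g (p + h *: w + s *: v) - 'D_v g (p + s *: v).
have Uhw s : 0 <= s <= h -> U (p + h *: w + s *: v).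
  by move=> sh; rewrite addrAC; exact: Uh.
have U0 s : 0 <= s <= h -> U (p + s *: v).
  by move=> sh; have := Uh s 0 sh h00; rewrite scale0r addr0.
have Ipsi s : 0 <= s <= h -> is_derive s 1 psi (dpsi s).
  move=> sh; apply: is_deriveB.
    by apply: is_derive_line; apply: dg; exact: Uhw.
  by apply: is_derive_line; apply: dg; exact: U0.
have [||s] := @MVT R psi dpsi 0 h h0.
- by move=> s; rewrite in_itv/= => /andP[/ltW s0 /ltW sh]; apply: Ipsi; rewrite s0.
- apply: derivable_within_continuous => s; rewrite in_itv/= => sh.
  by have [] := Ipsi s sh.
rewrite in_itv/= => /andP[/ltW s0 /ltW sh]; rewrite subr0 => psiE.
have s0h : 0 <= s <= h by rewrite s0.
pose phi (t : R) := 'D_v g (p + s *: v + t *: w).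
pose dphi t := 'D_w ('D_v g) (p + s *: v + t *: w).
have Iphi t : 0 <= t <= h -> is_derive t 1 phi (dphi t).
  by move=> th; apply: is_derive_line; apply: dDg; exact: Uh.
have [||t] := @MVT R phi dphi 0 h h0.
- by move=> t; rewrite in_itv/= => /andP[/ltW t0 /ltW th]; apply: Iphi; rewrite t0.
- apply: derivable_within_continuous => t; rewrite in_itv/= => th.
  by have [] := Iphi t th.
rewrite in_itv/= => /andP[/ltW t0 /ltW th]; rewrite subr0 => phiE.
exists s, t; split=> //; first by rewrite t0.
rewrite expr2 mulrA -[X in X * h]phiE /phi scale0r addr0.
rewrite (addrAC p (s *: v)) -psiE /psi scale0r !addr0 (addrAC p (h *: w)).
by rewrite opprD opprK addrA.
Qed.

(** Schwarz's theorem. The second difference is symmetric in [v] and [w], so the two mixed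
    derivatives coincide up to moving each to some point near [p]; continuity at [p] then brings
    them within any [e] of each other. *)
Lemma deriveC E (U : set E) (g : E -> R) p v w : open U -> U p -> Cn 2 U g ->
  'D_v ('D_w g) p = 'D_w ('D_v g) p.
Proof.
move=> oU Up Cg; have [dg Dg] := Cg.
have [_ /(_ w) cvw] := Dg v; have [_ /(_ v) cwv] := Dg w.
apply/eqP; rewrite -subr_eq0 -normr_le0; apply/ler_addgt0Pr => e e0.
rewrite add0r.
have e2 : 0 < e / 2 by rewrite divr_gt0.
have near_p : \forall q \near p, [/\ U q,
    `|'D_w ('D_v g) p - 'D_w ('D_v g) q| < e / 2 &
    `|'D_v ('D_w g) p - 'D_v ('D_w g) q| < e / 2].
  have n1 : \forall q \near p, `|'D_w ('D_v g) p - 'D_w ('D_v g) q| < e / 2.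
    exact: ((cvgrPdist_lt _ _).1 (cvw p Up) _ e2).
  have n2 : \forall q \near p, `|'D_v ('D_w g) p - 'D_v ('D_w g) q| < e / 2.
    exact: ((cvgrPdist_lt _ _).1 (cwv p Up) _ e2).
  have n3 : \forall q \near p, U q by exact: (near_open oU Up (fun q Uq => Uq)).
  by apply: filterS (filterI n3 (filterI n1 n2)) => q [Uq [q1 q2]]; split.
have [r /= r0 pr] := (nbhs_ballP _ _).1 near_p.
(* The step [h = r / (2 c)] keeps the parallelogram spanned by [h *: v] and [h *: w] within [r / 2]
   of [p]; the summand 1 makes [c] positive even when [v] and [w] vanish. *)
pose c := `|v| + `|w| + 1.
have c0 : 0 < c by rewrite ltr_wpDl// addr_ge0.
pose h := r / (2 * c).
have h0 : 0 < h by rewrite divr_gt0// mulr_gt0.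
have box s t : 0 <= s <= h -> 0 <= t <= h -> ball p r (p + s *: v + t *: w).
  move=> /andP[s0 sh] /andP[t0 th]; rewrite -ball_normE /ball_/=.
  rewrite -addrA opprD addrA subrr add0r normrN.
  rewrite (le_lt_trans (ler_normD _ _))// !normrZ !ger0_norm//.
  have hc : h * c = r / 2 by rewrite /h invfM mulrA mulfVK// gt_eqF.
  apply: (@le_lt_trans _ _ (h * c)).
    rewrite /c !mulrDr mulr1; apply: ler_wpDr; first exact: ltW.
    by apply: lerD; exact: ler_wpM2r.
  by rewrite hc ltr_pdivrMr// ltr_pMr// ltr1n.
have [|s [t [sh th E1]]] := second_difference h0 Cg (p := p) (v := v) (w := w).
  by move=> s t sh th; have [] := pr _ (box s t sh th).
have [|s' [t' [sh' th' E2]]] :=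
    second_difference h0 Cg (p := p) (v := w) (w := v).
  by move=> s' t' sh' th'; rewrite addrAC; have [] := pr _ (box t' s' th' sh').
have E3 : 'D_w ('D_v g) (p + s *: v + t *: w) =
    'D_v ('D_w g) (p + s' *: w + t' *: v).
  apply: (@mulIf _ (h ^+ 2)); first by rewrite expf_neq0// gt_eqF.
  by rewrite -E1 -E2 (addrAC p (h *: w)); congr (_ + _); exact: addrAC.
have [_ b1 _] := pr _ (box s t sh th).
have [_ _ b2] := pr _ (box t' s' th' sh').
rewrite E3 in b1; rewrite (addrAC p) in b2; rewrite (splitr e).
move: b1 b2; move: ('D_v ('D_w g) p) ('D_w ('D_v g) p).
move: ('D_v ('D_w g) _) => z x y yz xz.
apply: (le_trans (ler_distD z _ _)); apply: lerD; first exact: ltW.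
by rewrite distrC ltW.
Qed.

End directional_derivatives.

(** * Smoothness in a neighbourhood of a point *)

Section Cinf_theory.
Context {R : realType}.
Implicit Types E F G : normedModType R.

Lemma open_setI_preimage (E F : topologicalType) (U : set E) (V : set F)
    (f : E -> F) : open U ->
  (forall a, U a -> {for a, continuous f}) -> open V -> open (U `&` f @^-1` V).
Proof.
move=> oU cf oV; rewrite openE => a [Ua Va]; apply: filterI.
  exact: open_nbhs_nbhs.
by apply: (cf a Ua); exact: open_nbhs_nbhs.
Qed.

Lemma Cinf_near_ext E F (f g : E -> F) a :
  (\forall b \near a, f b = g b) -> Cinf_near f a -> Cinf_near g a.
Proof.
move=> fg [U [oU Ua Cf]].
have [V [oV Va] Vfg] : exists2 V, open_nbhs a V & V `<=` (fun b => f b = g b).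
  by move: fg; rewrite /prop_near1 nbhsE.
have oUV : open (U `&` V) by exact: openI.
exists (U `&` V); split=> // k; apply: (Cn_ext (f := f)) => //.
  by move=> b [_ Vb]; exact: Vfg.
by apply: Cn_subset (Cf k) => b [].
Qed.

Lemma Cinf_near_differentiable E F (f : E -> F) a :
  Cinf_near f a -> differentiable f a.
Proof. by move=> [U [_ Ua /(_ 1)[/(_ a Ua)]]]. Qed.

Lemma Cinf_near_near E F (f : E -> F) a :
  Cinf_near f a -> \forall b \near a, Cinf_near f b.
Proof.
move=> [U [oU Ua Cf]]; apply: (near_open oU Ua) => b Ub.
by exists U.
Qed.

Lemma Cinf_near2 E F F' G (f : E -> F) (g : E -> F') (h : E -> G) a :
  (forall k U, open U -> Cn k U f -> Cn k U g -> Cn k U h) ->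
  Cinf_near f a -> Cinf_near g a -> Cinf_near h a.
Proof.
move=> H [U [oU Ua Cf]] [V [oV Va Cg]].
have oUV : open (U `&` V) by exact: openI.
exists (U `&` V); split=> // k; apply: H => //.
  by apply: Cn_subset (Cf k) => b [].
by apply: Cn_subset (Cg k) => b [].
Qed.

Lemma Cinf_near1 E F G (f : E -> F) (h : E -> G) a :
  (forall k U, open U -> Cn k U f -> Cn k U h) ->
  Cinf_near f a -> Cinf_near h a.
Proof. by move=> H [U [oU Ua Cf]]; exists U; split=> // k; exact: H. Qed.

Lemma Cinf_near_cst E F (c : F) (a : E) : Cinf_near (cst c) a.
Proof. by exists setT; split=> // [|k]; [exact: openT|exact: Cn_cst]. Qed.

Lemma Cinf_near_comp_linear E F G (l : {linear E -> F}) (f : F -> G) a :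
  continuous l -> Cinf_near f (l a) -> Cinf_near (f \o l) a.
Proof.
move=> cl [U [oU Ua Cf]]; exists (l @^-1` U); split=> // [|k].
  by apply: open_comp => // b _; exact: cl.
exact: Cn_comp_linear.
Qed.

Lemma Cinf_near_comp E F (b : frame F) (f : E -> F) (g : F -> R) a :
  Cinf_near f a -> Cinf_near g (f a) -> Cinf_near (g \o f) a.
Proof.
move=> [U [oU Ua Cf]] [V [oV Va Cg]].
have oW : open (U `&` f @^-1` V) by apply: open_setI_preimage => //; exact: Cf 0%N.
exists (U `&` f @^-1` V); split=> // k.
apply: (Cn_comp b oW oV _ _ (Cg k)); first by move=> c [].
by apply: Cn_subset (Cf k) => c [].
Qed.

Lemma Cinf_near_derive_along E F (b : frame F) (f eta : E -> F) (g : F -> R) a :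
  Cinf_near f a -> Cinf_near eta a -> Cinf_near g (f a) ->
  Cinf_near (fun q => 'D_(eta q) g (f q)) a.
Proof.
move=> Cf Ce [V [oV Va Cg]].
(* Pairing the two maps produces a single neighbourhood on which both are smooth to every order; the
   projections then recover each of them. *)
have [U [oU Ua Cfe]] : Cinf_near (fun q => (f q, eta q)) a.
  apply: Cinf_near2 Cf Ce => k U oU Cf Ce.
  have := Cn_add oU (Cn_linear_comp (@inl0_continuous R F F) oU Cf)
    (Cn_linear_comp (@inr0_continuous R F F) oU Ce).
  by apply: Cn_ext => // c _; congr pair; rewrite /= ?addr0 ?add0r.
have Cf' k : Cn k U f.
  by apply: Cn_ext (Cn_linear_comp (@prl_continuous R F F) oU (Cfe k)).
have Ce' k : Cn k U eta.
  by apply: Cn_ext (Cn_linear_comp (@prr_continuous R F F) oU (Cfe k)).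
have oW : open (U `&` f @^-1` V) by apply: open_setI_preimage => //; exact: Cf' 0%N.
exists (U `&` f @^-1` V); split=> // k.
apply: (Cn_derive_along b oW oV _ _ _ (Cg k.+1)); first by move=> c [].
  by apply: Cn_subset (Cf' k) => c [].
by apply: Cn_subset (Ce' k) => c [].
Qed.

End Cinf_theory.

(** * Tangent vectors as functionals on germs *)

Section coord_vectors.
Context {R : realType} {V : normedModType R} {X : Type} {B : atlas V X}.

Lemma coord_vecE i a y f :
  smooth_at B (par B i a) f -> coord_vec i a y f = 'D_y (f \o par B i) a.
Proof. by move=> sf; rewrite /coord_vec asboolT. Qed.

Lemma coord_vec_nonsmooth i a y f :
  ~ smooth_at B (par B i a) f -> coord_vec i a y f = 0.
Proof. by move=> sf; rewrite /coord_vec asboolF. Qed.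

Lemma coord_vec_linear i a c y z f : dom B i a ->
  coord_vec (A := B) i a (c *: y + z) f =
  c * coord_vec i a y f + coord_vec i a z f.
Proof.
move=> da; rewrite /coord_vec; case: asboolP => [sf|_]; last by rewrite mulr0 addr0.
have df := Cinf_near_differentiable (sf i a da erefl).
by rewrite !deriveE// linearP.
Qed.

Lemma coord_vec_add i a y z : dom B i a ->
  coord_vec (A := B) i a (y + z) = coord_vec i a y + coord_vec (A := B) i a z.
Proof.
move=> da; apply/funext => f; rewrite -[y]scale1r coord_vec_linear// mul1r.
by rewrite scale1r.
Qed.

Lemma coord_vec0 i a : coord_vec (A := B) i a 0 = 0.
Proof.
apply/funext => f; rewrite /coord_vec; case: asboolP => // _.
by rewrite derive0.
Qed.

Lemma tangent_coord i a (v : tangent B (par B i a)) : dom B i a ->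
  exists y, tfun v = coord_vec i a y.
Proof. by move=> da; have /asboolP := tfunP v; exact. Qed.

(** The means of computing everything defined through [tvec] ([rho], [gamma], [bracketf], [vder]):
    [w] may be arbitrary on non-smooth functions, since [tvec] resets it to 0 there. *)
Lemma tvec_tangent x (w t : (X -> R) -> R) :
  is_tangent B x t -> (forall f, smooth_at B x f -> w f = t f) ->
  (forall f, ~ smooth_at B x f -> t f = 0) ->
  tfun (tvec B x w) = t.
Proof.
move=> ht wt t0; rewrite /tvec.
have -> : (fun f => if `[< smooth_at B x f >] then w f else 0) = t.
  by apply/funext => f; case: asboolP => [/wt//|/t0].
by have /asboolP h := ht; rewrite insubdK.
Qed.

End coord_vectors.

(** * Charts of the tangent bundle *)

Section charts.
Context {R : realType} {n : nat} {M : topologicalType} {A : atlas 'rV[R]_n M}.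
Hypothesis hA : smooth_manifold A.
Local Notation E := 'rV[R]_n.
Local Notation tm := (tm_atlas A).

Definition img (i : idx A) : set M := par A i @` dom A i.

Definition cinv (i : idx A) (x : M) : E :=
  xget 0 [set a | dom A i a /\ par A i a = x].

(** Coordinate functions extended to all of [M], so that tangent vectors can be tested on them;
    their values outside [img i] come from the default of [cinv]. *)
Definition cx (i : idx A) (k : 'I_n) : M -> R := entry k \o cinv i.

Lemma cinvP i x : img i x -> dom A i (cinv i x) /\ par A i (cinv i x) = x.
Proof.
move=> [a da ax]; rewrite /cinv; case: xgetP => [b _ //|/(_ a)].
by case; split.
Qed.

Lemma cinvK i a : dom A i a -> cinv i (par A i a) = a.
Proof.
move=> da; have [|db e] := @cinvP i (par A i a); first by exists a.
by apply: (mfd_par_inj hA i) => //; exact/mem_set.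
Qed.

Definition overlap i j : set E := [set a | dom A i a /\ img j (par A i a)].

Lemma open_overlap i j : open (overlap i j).
Proof.
exact: (open_setI_preimage (mfd_dom_open hA i) (mfd_par_continuous hA i)
  (mfd_par_open hA j _ (mfd_dom_open hA j) (@subset_refl _ _))).
Qed.

(** Injectivity of [par A j] forces the smooth transition map supplied by the manifold structure to
    coincide with this one on the overlap. *)
Lemma transition_smooth i j : Cinf (overlap i j) (cinv j \o par A i).
Proof.
have [h [hW Ch]] := mfd_transition hA i j.
move=> k; apply: Cn_ext (Ch k) => [|a Wa]; first exact: open_overlap.
by have [dh e] := hW a Wa; rewrite /= -e cinvK.
Qed.

Lemma cx_smooth j k x : img j x -> smooth_at A x (cx j k).
Proof.
move=> jx i a da ax; exists (overlap i j); split.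
- exact: open_overlap.
- by split=> //; rewrite ax.
move=> l; apply: Cn_ext (Cn_linear_comp (@entry_continuous R n k)
  (@open_overlap i j) (@transition_smooth i j l)) => //; exact: open_overlap.
Qed.

Definition vec i a y : tangent A (par A i a) :=
  tvec A (par A i a) (coord_vec i a y).

Lemma vecE i a y : dom A i a -> tfun (vec i a y) = coord_vec i a y.
Proof. by move=> da; exact: tvec_coord_vec. Qed.

Lemma coord_vec_cx i a y k : dom A i a -> coord_vec i a y (cx i k) = entry k y.
Proof.
move=> da; rewrite coord_vecE; last by apply: cx_smooth; exists a.
have -> : 'D_y (cx i k \o par A i) a = 'D_y (entry k) a.
  apply: near_eq_derive; apply: near_open (mfd_dom_open hA i) da _ => b db.
  by rewrite /cx /= cinvK.
have ck := @entry_continuous R n k.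
by rewrite deriveE ?diff_lin//; exact: linear_differentiable.
Qed.

Lemma coord_vec_inj i a y z : dom A i a ->
  coord_vec (A := A) i a y = coord_vec (A := A) i a z -> y = z.
Proof.
move=> da e; apply/rowP => k.
by have := congr1 (fun w => w (cx i k)) e; rewrite !coord_vec_cx.
Qed.

Lemma TM_eq (u v : TM A) :
  base u = base v -> tfun (fibre u) = tfun (fibre v) -> u = v.
Proof.
case: u v => [x v] [y w] /= xy; case: _ / xy w => w vw.
by congr existT; exact: val_inj.
Qed.

Lemma fibre_par i p : dom A i p.1 ->
  tfun (fibre (par tm i p)) = coord_vec (A := A) i p.1 p.2.
Proof. exact: vecE. Qed.

Lemma TM_chart (u : TM A) : exists i p, dom A i p.1 /\ par tm i p = u.
Proof.
have [i [a [da ax]]] := mfd_cover hA (base u).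
case: u ax => x v /= ax; case: _ / ax v => v.
have [y vy] := tangent_coord v da.
by exists i, (a, y); split=> //; apply: TM_eq => //; rewrite fibre_par.
Qed.

Definition tminv (i : idx A) (u : TM A) : (E * E)%type :=
  (cinv i (base u), \row_k fibre u (cx i k)).

Lemma tminvK i p : dom A i p.1 -> tminv i (par tm i p) = p.
Proof.
case: p => a y /= da; congr pair; first exact: cinvK.
by apply/rowP => k; rewrite mxE (@fibre_par i (a, y))//= coord_vec_cx.
Qed.

Lemma tminvP i (u : TM A) : img i (base u) ->
  dom A i (tminv i u).1 /\ par tm i (tminv i u) = u.
Proof.
case: u => x v; rewrite [base _]/= => -[a da ax]; case: _ / ax v => v.
have [y vy] := tangent_coord v da.
have -> : existT _ (par A i a) v = par tm i (a, y) :> TM A.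
  by apply: TM_eq => //; rewrite fibre_par.
by rewrite tminvK.
Qed.

Definition tm_overlap i j : set (E * E)%type := prl @^-1` overlap i j.

Lemma open_tm_overlap i j : open (tm_overlap i j).
Proof.
apply: open_comp; last exact: open_overlap.
by move=> p _; exact: prl_continuous.
Qed.

(** The fibre part of the chart change is the derivative of the base transition at [p.1] along
    [p.2], so it consumes one more order of smoothness than the base part. *)
Lemma tm_transition_smooth i j : Cinf (tm_overlap i j) (tminv j \o par tm i).
Proof.
move=> k; apply: (Cn_frame (b := prod_frame (rV_frame n) (rV_frame n))).
  exact: open_tm_overlap.
case=> l.
- have C1 := Cn_linear_comp (@entry_continuous R n l) (@open_overlap i j)
    (@transition_smooth i j k).
  have := Cn_comp_linear (@prl_continuous R E E) C1.
  by apply: Cn_ext => //; exact: open_tm_overlap.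
- have C1 := Cn_linear_comp (@entry_continuous R n l) (@open_overlap i j)
    (@transition_smooth i j k.+1).
  have := Cn_derive_along (rV_frame n) (@open_tm_overlap i j) (@open_overlap i j)
    (fun _ h => h) (Cn_linear k _ (@prl_continuous R E E))
    (Cn_linear k _ (@prr_continuous R E E)) C1.
  apply: Cn_ext => [|p [da ja]]; first exact: open_tm_overlap.
  rewrite /= /entry mxE fibre_par// coord_vecE//.
  exact: cx_smooth.
Qed.

Lemma tm_transition_near i j p : tm_overlap i j p ->
  Cinf_near (tminv j \o par tm i) p.
Proof.
move=> ijp; exists (tm_overlap i j); split=> //; first exact: open_tm_overlap.
exact: tm_transition_smooth.
Qed.

Lemma par_tminv_near i j p : tm_overlap i j p -> forall F : TM A -> R,
  \forall q \near p, (F \o par tm i) q = ((F \o par tm j) \o (tminv j \o par tm i)) q.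
Proof.
move=> ijp F; apply: near_open (@open_tm_overlap i j) ijp _ => q [dq jq].
by have [_ e] := @tminvP j (par tm i q) jq; rewrite /comp e.
Qed.

Lemma tm_overlapP i j p q : dom A i p.1 -> dom A j q.1 ->
  par tm i p = par tm j q -> tm_overlap i j p /\ tminv j (par tm i p) = q.
Proof.
move=> dp dq pq; split; last by rewrite pq tminvK.
by split=> //; exists q.1 => //; exact/esym/(congr1 (@base _ _ _ A) pq).
Qed.

(** [smooth_at] quantifies over all charts; composing with the smooth chart change reduces it to
    one. *)
Lemma tm_smooth_chart i p (F : TM A -> R) : dom A i p.1 ->
  Cinf_near (F \o par tm i) p -> smooth_at tm (par tm i p) F.
Proof.
move=> dp CF j q dq qp; have [jiq e] := tm_overlapP dq dp qp.
apply: (Cinf_near_ext (f := (F \o par tm i) \o (tminv i \o par tm j))).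
  by apply: filterS (par_tminv_near jiq F) => r ->.
apply: (Cinf_near_comp (prod_frame (rV_frame n) (rV_frame n))).
  exact: tm_transition_near.
by rewrite /= e.
Qed.

Lemma near_dom i (p : E * E) : dom A i p.1 -> \forall q \near p, dom A i q.1.
Proof.
move=> dp; have od : open (prl @^-1` dom A i : set (E * E)%type).
  apply: open_comp; last exact: (mfd_dom_open hA).
  by move=> q _; exact: prl_continuous.
by apply: near_open od dp _.
Qed.

Lemma tm_smooth_near i p (F : TM A -> R) : dom A i p.1 ->
  smooth_at tm (par tm i p) F ->
  \forall q \near p, smooth_at tm (par tm i q) F.
Proof.
move=> dp sF; have C := Cinf_near_near (sF i p dp erefl).
apply: filterS (filterI (near_dom dp) C) => q [dq Cq].
exact: tm_smooth_chart.
Qed.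

(** Counterpart on [TM] of [coord_vec_tangent], whose atlas is modelled on row vectors rather than
    on pairs: components transform by the derivative of the chart change. *)
Lemma tm_coord_vec_tangent i p xi : dom A i p.1 ->
  is_tangent tm (par tm i p) (coord_vec (A := tm) i p xi).
Proof.
move=> dp j q dq qp; have [ijp e] := tm_overlapP dp dq (esym qp).
exists ('D_xi (tminv j \o par tm i) p); apply/funext => F; rewrite /coord_vec qp.
case: asboolP => [sF|_]; last reflexivity.
have dt := Cinf_near_differentiable (tm_transition_near ijp).
have dF : differentiable (F \o par tm j) ((tminv j \o par tm i) p).
  by rewrite /= e; exact/Cinf_near_differentiable/(sF j q dq qp).
rewrite (near_eq_derive _ (par_tminv_near ijp F)).
rewrite [LHS]deriveE; last exact: differentiable_comp.
by rewrite (diff_comp dt dF)/= -(deriveE _ dt) e -deriveE// -e.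
Qed.

End charts.

(** * Horizontal and vertical projections, the fibre metric *)

Lemma derive1_line {R : realType} {E : normedModType R} (g : E -> R) p v :
  derive1 (fun t : R => g (p + t *: v)) 0 = 'D_v g p.
Proof.
rewrite /derive1 /derive; apply: (congr1 (fun h : R -> R => lim (h @ 0^'))).
by apply/funext => h /=; rewrite addr0 scale0r addr0 [p + _]addrC.
Qed.

Section lifts.
Context {R : realType} {n : nat} {M : topologicalType} {A : atlas 'rV[R]_n M}.
Hypothesis hA : smooth_manifold A.
Local Notation E := 'rV[R]_n.
Local Notation tm := (tm_atlas A).
Local Notation vinc := (@inr0 R E E).

(** Charts of [TM] are linear on each fibre, so translation inside a fibre is straight motion in the
    second component. *)
Lemma par_add_fibre i (p : E * E) (c : E) t (v : tangent A (base (par tm i p))) :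
  dom A i p.1 -> tfun v = coord_vec (A := A) i p.1 c ->
  add_fibre (t *: v) = par tm i (p + t *: vinc c).
Proof.
move=> dp vc.
have e1 : (p + t *: vinc c).1 = p.1 by rewrite /= scaler0 addr0.
apply: (TM_eq (A := A)); first by rewrite /= scaler0 addr0.
rewrite (fibre_par hA); last by rewrite e1.
rewrite e1; apply/funext => f.
have -> : (p + t *: vinc c).2 = t *: c + p.2 by rewrite /= addrC.
rewrite (coord_vec_linear)// -vc -(fibre_par hA)//.
by rewrite addrC.
Qed.

Lemma gamma_par i (p : E * E) (c : E) (v : tangent A (base (par tm i p))) :
  dom A i p.1 -> tfun v = coord_vec (A := A) i p.1 c ->
  tfun (gamma v) = coord_vec (A := tm) i p (vinc c).
Proof.
move=> dp vc; apply: tvec_tangent.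
- exact: (tm_coord_vec_tangent hA).
- move=> F sF; rewrite coord_vecE// -derive1_line; congr (derive1 _ 0).
  by apply/funext => t; rewrite (par_add_fibre t dp vc).
- by move=> F; exact: coord_vec_nonsmooth.
Qed.

Lemma smooth_base (u : TM A) f :
  smooth_at A (base u) f -> smooth_at tm u (f \o @base _ _ _ A).
Proof.
move=> sf i p dp pu.
have /= := @Cinf_near_comp_linear R _ _ _ _ (f \o par A i) p (@prl_continuous R E E).
by apply; apply: sf => //; rewrite -pu.
Qed.

Lemma rho_par i (p : E * E) xi (w : tangent tm (par tm i p)) :
  dom A i p.1 -> tfun w = coord_vec (A := tm) i p xi ->
  tfun (rho (par tm i p) w) = coord_vec (A := A) i p.1 xi.1.
Proof.
move=> dp wx; apply: tvec_tangent.
- exact: coord_vec_tangent.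
- move=> f sf; rewrite wx coord_vecE; last exact: (smooth_base (u := par tm i p)).
  by rewrite coord_vecE// -[RHS](derive_comp_linear (@prl R E E) (f \o par A i)).
- by move=> F; exact: coord_vec_nonsmooth.
Qed.

Lemma coord_vec_base i (p : E * E) (xi xi' : E * E) (f : M -> R) :
  xi.1 = xi'.1 ->
  coord_vec (A := tm) i p xi (f \o @base _ _ _ A) =
  coord_vec (A := tm) i p xi' (f \o @base _ _ _ A).
Proof.
move=> e; rewrite /coord_vec; case: asboolP => [_|_]; last reflexivity.
transitivity ('D_(prl xi) (f \o par A i) (prl p)).
  exact: (derive_comp_linear (@prl R E E) (f \o par A i)).
rewrite [prl xi]e; apply/esym.
exact: (derive_comp_linear (@prl R E E) (f \o par A i)).
Qed.

(** A function pulled back from [M] only sees the base component of a direction. This is why two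
    horizontal lifts of the same vector are interchangeable on such functions. *)
Lemma rho_eq_base (u : TM A) (w w' : tangent tm u) : rho u w = rho u w' ->
  forall f : M -> R, w (f \o @base _ _ _ A) = w' (f \o @base _ _ _ A).
Proof.
have [i [p [dp pu]]] := TM_chart hA u; case: _ / pu w w' => w w'.
have [xi wx] := tangent_coord w dp; have [xi' wx'] := tangent_coord w' dp.
move=> /(congr1 (@tfun _ _ _ _ _)); rewrite (rho_par dp wx) (rho_par dp wx').
move=> e f; rewrite wx wx'; apply: coord_vec_base.
exact: (coord_vec_inj hA dp e).
Qed.

Lemma gamma_base (u : TM A) (v : tangent A (base u)) (f : M -> R) :
  gamma v (f \o @base _ _ _ A) = 0.
Proof.
have [i [p [dp pu]]] := TM_chart hA u; case: _ / pu v => v.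
have [c vc] := tangent_coord v dp.
rewrite (gamma_par dp vc).
by rewrite (@coord_vec_base i p (vinc c) 0 f erefl) coord_vec0.
Qed.

Lemma tangent_cst0 (u : TM A) (w : tangent tm u) : w (fun=> 0) = 0.
Proof.
have [i [p [dp pu]]] := TM_chart hA u; case: _ / pu w => w.
have [c ->] := tangent_coord w dp.
rewrite /coord_vec; case: asboolP => // _.
exact: (derive_cst (V := (E * E)%type) (0 : R)).
Qed.

Lemma rho_gamma (u : TM A) (v : tangent A (base u)) : rho u (gamma v) = 0.
Proof.
have [i [p [dp pu]]] := TM_chart hA u; case: _ / pu v => v.
have [c vc] := tangent_coord v dp; apply: val_inj.
exact: etrans (rho_par dp (gamma_par dp vc)) (coord_vec0 _ _).
Qed.

Lemma rho_surj (u : TM A) (v : tangent A (base u)) :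
  exists w : tangent tm u, rho u w = v.
Proof.
have [i [p [dp pu]]] := TM_chart hA u; case: _ / pu v => v.
have [c vc] := tangent_coord v dp.
(* Any fibre component would do; this lift is the one constant along the fibre in the chosen
   chart. *)
have tw : tangent_pred tm (par tm i p) (coord_vec (A := tm) i p (c, 0)).
  by apply/asboolP; exact: (tm_coord_vec_tangent hA).
exists (Tangent tw); apply: val_inj; rewrite [RHS]vc.
exact: (rho_par (xi := (c, 0))).
Qed.

Lemma rho_add (u : TM A) (w w' : tangent tm u) : rho u (w + w') = rho u w + rho u w'.
Proof.
have [i [p [dp pu]]] := TM_chart hA u; case: _ / pu w w' => w w'.
have [xi wx] := tangent_coord w dp; have [xi' wx'] := tangent_coord w' dp.
have we : tfun (w + w') = coord_vec (A := tm) i p (xi + xi').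
  by rewrite coord_vec_add// -wx -wx'.
apply: val_inj; rewrite [LHS](rho_par dp we) coord_vec_add//.
by rewrite -(rho_par dp wx) -(rho_par dp wx').
Qed.

End lifts.

(** * Germs over nonzero vectors and the fibrewise Hessian *)

Section germs.
Context {R : realType} {n : nat} {M : topologicalType} {A : atlas 'rV[R]_n M}.
Hypothesis hA : smooth_manifold A.
Local Notation E := 'rV[R]_n.
Local Notation tm := (tm_atlas A).
Local Notation vinc := (@inr0 R E E).

Lemma slit_par i (p : E * E) : dom A i p.1 -> slit (par tm i p) <-> p.2 <> 0.
Proof.
move=> dp; split=> [/eqP s p0|p0].
  apply: s; apply: val_inj; apply: etrans (fibre_par hA dp) _.
  by rewrite p0 coord_vec0.
apply/eqP => s; apply: p0; apply: (coord_vec_inj hA dp).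
rewrite coord_vec0; apply: etrans (esym (fibre_par hA dp)) _.
exact: (congr1 (@tfun _ _ _ _ _) s).
Qed.

Lemma slit_near i (p : E * E) : dom A i p.1 -> slit (par tm i p) ->
  \forall q \near p, dom A i q.1 /\ slit (par tm i q).
Proof.
move=> dp /(slit_par dp) p0.
have o : open (prr @^-1` [set~ 0] : set (E * E)%type).
  apply: open_comp; first by move=> q _; exact: prr_continuous.
  apply: closed_openC; apply: accessible_closed_set1.
  exact: hausdorff_accessible (@norm_hausdorff _ _).
have nz : \forall q \near p, (prr @^-1` [set~ 0]) q by exact: near_open o p0 _.
apply: filterS (filterI (near_dom hA dp) nz) => q [dq q0]; split=> //.
exact/(slit_par dq).
Qed.

(** Nearness on [TM] is read in the charts, the same way as smoothness. *)
Definition germ_eq (u : TM A) (F G : TM A -> R) := forall i p,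
  dom tm i p -> par tm i p = u ->
  \forall q \near p, F (par tm i q) = G (par tm i q).

Lemma germ_sym u F G : germ_eq u F G -> germ_eq u G F.
Proof. by move=> FG i p dp pu; apply: filterS (FG i p dp pu) => q ->. Qed.

Lemma germ_slit u F G : (forall v, slit v -> F v = G v) -> slit u ->
  germ_eq u F G.
Proof.
move=> FG su i p dp pu; rewrite -pu in su.
by apply: filterS (slit_near dp su) => q [_]; exact: FG.
Qed.

Lemma smooth_germ u F G : germ_eq u F G -> smooth_at tm u F -> smooth_at tm u G.
Proof.
move=> FG sF i p dp pu.
exact: (Cinf_near_ext (FG i p dp pu) (sF i p dp pu)).
Qed.

(** Smoothness is a property of the germ, so [F] and [G] are either both differentiated or both sent
    to 0. *)
Lemma tangent_germ u (w : tangent tm u) F G : germ_eq u F G -> w F = w G.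
Proof.
move=> FG; have GF := germ_sym FG.
have [i [p [dp pu]]] := TM_chart hA u; case: _ / pu w FG GF => w FG GF.
have [xi ->] := tangent_coord w dp.
have [sF|sF] := pselect (smooth_at tm (par tm i p) F); last first.
  rewrite !coord_vec_nonsmooth// => sG; apply: sF; exact: smooth_germ GF sG.
rewrite !coord_vecE//; last exact: smooth_germ FG sF.
by apply: near_eq_derive; exact: FG.
Qed.

Lemma smooth_mul u F G : smooth_at tm u F -> smooth_at tm u G ->
  smooth_at tm u (fun v => F v * G v).
Proof.
move=> sF sG i p dp pu.
apply: Cinf_near2 (sF i p dp pu) (sG i p dp pu) => k U oU CF CG.
exact: (Cn_mul oU CF CG).
Qed.

Lemma smooth_expR_base u (s : M -> R) : smooth_at A (base u) s ->
  smooth_at tm u (fun v => expR (s (base v))).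
Proof.
move=> /smooth_base ss i p dp pu.
by apply: Cinf_near1 (ss i p dp pu) => k U oU; exact: Cn_expR.
Qed.

(** The factor is constant along fibres, so its term in the product rule vanishes. [F] is arbitrary:
    multiplication by [expR (- s)] recovers it from the product, hence if [F] is not smooth both
    sides are 0. The lemma thus applies directly to [g (Y, Z)]. *)
Lemma gamma_expR_mul u (v : tangent A (base u)) (s : M -> R) (F : TM A -> R) :
  smooth_at A (base u) s ->
  gamma v (fun x => expR (s (base x)) * F x) = expR (s (base u)) * gamma v F.
Proof.
move=> ss; set G := (fun x => _ * _).
have sG : smooth_at tm u F -> smooth_at tm u G.
  by move=> sF; exact: smooth_mul (smooth_expR_base ss) sF.
have sF : smooth_at tm u G -> smooth_at tm u F.
  move=> sg; have sn : smooth_at A (base u) (fun x => - s x).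
    move=> i p dp pu; apply: Cinf_near1 (ss i p dp pu) => k U oU Cs.
    have := Cn_mul oU (@Cn_cst R E R k U (-1)) Cs.
    by apply: Cn_ext => // a _; rewrite /= mulN1r.
  have := smooth_mul (smooth_expR_base sn) sg.
  rewrite (_ : (fun x => _ * _) = F)//; apply/funext => x.
  by rewrite mulrA -expRD addNr expR0 mul1r.
have [i [p [dp pu]]] := TM_chart hA u.
case: _ / pu v ss @G sG sF => v ss G sG sF.
have [c vc] := tangent_coord v dp; rewrite (gamma_par hA dp vc).
have [sFu|sFu] := pselect (smooth_at tm (par tm i p) F); last first.
  by rewrite !coord_vec_nonsmooth ?mulr0// => /sF.
rewrite !coord_vecE//; last exact: sG.
have dF := Cinf_near_differentiable (sFu i p dp erefl).
have se := smooth_expR_base (u := par tm i p) ss.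
have de := Cinf_near_differentiable (se i p dp erefl).
have e0 : 'D_(vinc c) ((fun v => expR (s (base v))) \o par tm i) p = 0.
  have := coord_vec_base i p (xi := vinc c) (xi' := 0) (fun x => expR (s x)) erefl.
  by rewrite coord_vec0 coord_vecE.
by rewrite [LHS](deriveM (diff_derivable de) (diff_derivable dF)) e0 scaler0 addr0.
Qed.

Lemma finsler_metric_par (L : TM A -> R) i (p : E * E) (c d : E)
    (v w : tangent A (base (par tm i p))) : dom A i p.1 ->
  tfun v = coord_vec (A := A) i p.1 c -> tfun w = coord_vec (A := A) i p.1 d ->
  finsler_metric L v w =
  2^-1 * 'D_(vinc c) ('D_(vinc d) (fun q => L (par tm i q) ^+ 2)) p.
Proof.
move=> dp vc wd; apply: (congr1 ( *%R 2^-1)).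
rewrite -derive1_line; congr (derive1 _ 0).
apply/funext => s; rewrite -derive1_line; congr (derive1 _ 0).
apply/funext => t; congr (L _ ^+ 2).
have svtw : tfun (s *: v + t *: w) = coord_vec (A := A) i p.1 (s *: c + t *: d).
  apply/funext => f; rewrite (coord_vec_linear _ _ _ _ dp).
  rewrite -[t *: d]addr0 (coord_vec_linear _ _ _ _ dp) coord_vec0 -vc -wd.
  by rewrite addr0.
have := par_add_fibre hA 1 dp svtw; rewrite !scale1r => ->.
by congr (par tm i _); rewrite -addrA linearD !linearZ.
Qed.

Lemma square_smooth (L : TM A -> R) u : smooth_at tm u L ->
  smooth_at tm u (fun q => L q ^+ 2).
Proof.
move=> sL; have -> : (fun q => L q ^+ 2) = (fun q => L q * L q).
  by apply/funext => q; rewrite expr2.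
exact: smooth_mul.
Qed.

Lemma finsler_metric_linearl (L : TM A -> R) u k
    (v v' w : tangent A (base u)) : smooth_at tm u L ->
  finsler_metric L (k *: v + v') w =
  k * finsler_metric L v w + finsler_metric L v' w.
Proof.
move=> /square_smooth sL; have [i [p [dp pu]]] := TM_chart hA u.
case: _ / pu v v' w sL => v v' w sL.
have [c vc] := tangent_coord v dp; have [c' vc'] := tangent_coord v' dp.
have [d wd] := tangent_coord w dp.
have vv : tfun (k *: v + v') = coord_vec (A := A) i p.1 (k *: c + c').
  by apply/funext => f; rewrite coord_vec_linear// -vc -vc'.
rewrite (finsler_metric_par L dp vv wd) (finsler_metric_par L dp vc wd).
rewrite (finsler_metric_par L dp vc' wd).
have [U [oU Up /(_ 2)[_ /(_ (vinc d))[dD _]]]] := sL i p dp erefl.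
have dDp := dD p Up.
rewrite mulrCA -mulrDr; congr (_ * _).
by rewrite !(deriveE _ dDp) linearP linearP.
Qed.

(** Here the varied direction is that of the inner derivative, so linearity is needed at all points
    near [p] before the outer derivative is taken; for the left argument it was enough at [p]
    itself. *)
Lemma finsler_metric_linearr (L : TM A -> R) u k
    (v w w' : tangent A (base u)) : smooth_at tm u L ->
  finsler_metric L v (k *: w + w') =
  k * finsler_metric L v w + finsler_metric L v w'.
Proof.
move=> /square_smooth sL; have [i [p [dp pu]]] := TM_chart hA u.
case: _ / pu v w w' sL => v w w' sL.
have [c vc] := tangent_coord v dp; have [d wd] := tangent_coord w dp.
have [d' wd'] := tangent_coord w' dp.
have ww : tfun (k *: w + w') = coord_vec (A := A) i p.1 (k *: d + d').
  by apply/funext => f; rewrite coord_vec_linear// -wd -wd'.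
rewrite (finsler_metric_par L dp vc ww) (finsler_metric_par L dp vc wd).
rewrite (finsler_metric_par L dp vc wd').
have [U [oU Up /(_ 2)[dG DG]]] := sL i p dp erefl.
set G := (_ \o _) in dG DG.
have dDp z : derivable ('D_z G) p (vinc c).
  by apply: diff_derivable; have [dD _] := DG z; exact: dD.
rewrite mulrCA -mulrDr; congr (_ * _).
transitivity ('D_(vinc c) (k \*: 'D_(vinc d) G + 'D_(vinc d') G) p); last first.
  by rewrite deriveD// ?deriveZ//; exact: derivableZ.
apply: near_eq_derive; apply: near_open oU Up _ => q Uq.
have -> : vinc (k *: d + d') = k *: vinc d + vinc d' by rewrite linearP.
change ('D_(k *: vinc d + vinc d') G q =
  k *: 'D_(vinc d) G q + 'D_(vinc d') G q).
by rewrite !(deriveE _ (dG q Uq)) linearP.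
Qed.

End germs.

(** * Comparison of the two connections *)

Section connections.
Context {R : realType} {n : nat} {M : topologicalType} {A : atlas 'rV[R]_n M}.
Hypothesis hA : smooth_manifold A.
Local Notation E := 'rV[R]_n.
Local Notation tm := (tm_atlas A).
Local Notation vinc := (@inr0 R E E).

Lemma pi_smooth_ext (Y Z : pi_field A) : (forall u, slit u -> Y u = Z u) ->
  pi_smooth Y -> pi_smooth Z.
Proof.
move=> YZ sY u su i p dp pu; have [eta Ce He] := sY u su i p dp pu.
exists eta => //; rewrite -pu in su.
apply: filterS (filterI (slit_near hA dp su) He) => q [[_ sq] <-].
by rewrite YZ.
Qed.

Lemma pi_smooth_linear (c : R) (Y Z : pi_field A) : pi_smooth Y ->
  pi_smooth Z -> pi_smooth (fun u => c *: Y u + Z u).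
Proof.
move=> sY sZ u su i p dp pu; have [eta Ce He] := sY u su i p dp pu.
have [zeta Cz Hz] := sZ u su i p dp pu.
exists (fun q => c *: eta q + zeta q).
  apply: Cinf_near2 Ce Cz => k U oU Ce Cz.
  have cc := @scaler_continuous R E c.
  exact: (Cn_add oU (Cn_linear_comp (l := ( *:%R c)) cc oU Ce) Cz).
apply: filterS (filterI (near_dom hA dp) (filterI He Hz)) => q [dq [e1 e2]].
by apply/funext => f; rewrite coord_vec_linear// -e1 -e2.
Qed.

Lemma pi_smooth_cst0 : pi_smooth (fun u : TM A => 0 : tangent A (base u)).
Proof.
move=> u su i p dp pu; exists (cst 0); first exact: Cinf_near_cst.
by apply: filterS (near_dom hA dp) => q _; rewrite coord_vec0.
Qed.

Lemma pi_smooth_add (Y Z : pi_field A) : pi_smooth Y -> pi_smooth Z ->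
  pi_smooth (fun u => Y u + Z u).
Proof.
move=> sY sZ; apply: pi_smooth_ext (pi_smooth_linear 1 sY sZ) => u _.
by rewrite scale1r.
Qed.

Lemma pi_smooth_opp (Y : pi_field A) : pi_smooth Y ->
  pi_smooth (fun u => - Y u).
Proof.
move=> sY; apply: pi_smooth_ext (pi_smooth_linear (-1) sY pi_smooth_cst0) => u _.
by rewrite scaleN1r addr0.
Qed.

Lemma pi_smooth_sub (Y Z : pi_field A) : pi_smooth Y -> pi_smooth Z ->
  pi_smooth (fun u => Y u - Z u).
Proof. by move=> sY sZ; exact: pi_smooth_add sY (pi_smooth_opp sZ). Qed.

Lemma gammaf_smooth (Y : pi_field A) : pi_smooth Y ->
  forall u, slit u -> field_smooth_at u (gammaf Y).
Proof.
move=> sY u su i p dp pu; have [eta Ce He] := sY u su i p dp pu.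
exists (vinc \o eta).
  apply: Cinf_near1 Ce => k U oU.
  exact: (Cn_linear_comp (@inr0_continuous R E E)).
apply: filterS (filterI (near_dom hA dp) He) => q [dq e].
exact: (gamma_par hA dq e).
Qed.

Section one_connection.
Variables (D : connection A) (cD : is_connection D).

Lemma cov_gammaf_smooth (X Y : pi_field A) : pi_smooth X -> pi_smooth Y ->
  pi_smooth (cov D (gammaf X) Y).
Proof. by move=> sX sY; exact: (conn_smooth cD (gammaf_smooth sX) sY). Qed.

Lemma conn_cst0 u w : slit u ->
  D w (fun v : TM A => 0 : tangent A (base v)) = 0 :> tangent A (base u).
Proof.
move=> su.
have := conn_add cD w su pi_smooth_cst0 pi_smooth_cst0.
have -> : (fun v : TM A => 0 + 0 : tangent A (base v)) = (fun=> 0).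
  by apply: functional_extensionality_dep => v; rewrite addr0.
by move=> /esym/eqP; rewrite -subr_eq0 addrK => /eqP.
Qed.

(* A section vanishing on the slit bundle is its own product with the
   indicator of the zero section, which is smooth on the slit bundle. *)
Lemma conn_vanish u (w : tangent tm u) (Y : pi_field A) : slit u ->
  pi_smooth Y -> (forall v, slit v -> Y v = 0) -> D w Y = 0.
Proof.
move=> su sY Y0; pose F (v : TM A) : R := if slit v then 0 else 1.
have sF : smooth_fun F.
  move=> v sv; apply: (smooth_germ (F := cst 0)).
    by apply: (germ_slit hA) => // v' sv'; rewrite /F sv'.
  by move=> i p dp pu; exact: Cinf_near_cst.
have FY : (fun v => F v *: Y v) = Y.
  apply: functional_extensionality_dep => v; rewrite /F.
  by case: ifPn => [/Y0 ->|_]; rewrite ?scaler0 ?scale1r.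
have := conn_leibniz cD w su sF sY.
by rewrite FY Y0// {2}/F su scaler0 scale0r addr0.
Qed.

Lemma conn_sub u (w : tangent tm u) (Y Z : pi_field A) : slit u ->
  pi_smooth Y -> pi_smooth Z -> D w (fun v => Y v - Z v) = D w Y - D w Z.
Proof.
move=> su sY sZ; apply/eqP; rewrite eq_sym subr_eq; apply/eqP.
rewrite -(conn_add cD w su (pi_smooth_sub sY sZ) sZ); congr (D w _).
by apply: functional_extensionality_dep => v; rewrite subrK.
Qed.

(** Permits replacing a section by another one that agrees with it over nonzero vectors only, as
    with [rhof (betaf D Y)] and [Y]. *)
Lemma conn_local u (w : tangent tm u) (Y Z : pi_field A) : slit u ->
  pi_smooth Y -> pi_smooth Z -> (forall v, slit v -> Y v = Z v) ->
  D w Y = D w Z.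
Proof.
move=> su sY sZ YZ; apply/eqP; rewrite -subr_eq0 -conn_sub//; apply/eqP.
apply: conn_vanish => //; first exact: pi_smooth_sub.
by move=> v sv; rewrite YZ// subrr.
Qed.

(** Regularity makes the set searched by [beta] nonempty: the horizontal part of any lift of [v]
    still projects to [v], as the vertical part projects to 0. *)
Lemma rho_beta u (v : tangent A (base u)) : regular D -> slit u ->
  rho u (beta D v) = v.
Proof.
move=> rD su; have [w wv] := rho_surj hA v.
have [_ /(_ w)[vw [h [vv hh wE]]]] := rD u su.
have : exists h : tangent tm u, horizontal D h /\ rho u h = v.
  by exists h; split=> //; rewrite -wv wE rho_add// vv add0r.
by move=> /(@xgetPex _ 0) [].
Qed.

(** The derivative along [beta Y] drops out because it is applied to [rho (gamma X)], the zero
    section; the one along [gamma X] is applied to [rho (beta Y)], which is [Y] over nonzero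
    vectors. *)
Lemma torsionT_eq (X Y : pi_field A) u : regular D -> pi_smooth X ->
  pi_smooth Y -> slit u ->
  torsionT D X Y u =
  D (gamma (X u)) Y - rho u (bracket (gammaf X) (betaf D Y) u).
Proof.
move=> rD sX sY su; rewrite /torsionT /torsion /cov; congr (_ - _).
have -> : rhof (gammaf X) = (fun=> 0).
  by apply: functional_extensionality_dep => v; exact: (rho_gamma hA).
rewrite conn_cst0// subr0; have rbY v : slit v -> Y v = rhof (betaf D Y) v.
  by move=> sv; rewrite /rhof /betaf rho_beta.
by apply/esym/conn_local => //; exact: pi_smooth_ext sY.
Qed.

End one_connection.

(** [rho] tests the bracket on functions [f \o base] only. There [gamma X] gives 0, and [beta Y]
    acts through its projection [Y], which is the same for both connections. *)
Lemma rho_bracket_beta (D D' : connection A) (X Y : pi_field A) u :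
  regular D -> regular D' -> slit u ->
  rho u (bracket (gammaf X) (betaf D Y) u) =
  rho u (bracket (gammaf X) (betaf D' Y) u).
Proof.
move=> rD rD' su; congr tvec; apply/funext => f; rewrite /bracket.
have g0 : (fun v => gammaf X v (f \o @base _ _ _ A)) = (fun=> 0).
  by apply/funext => v; exact: (gamma_base hA).
rewrite g0 !(tangent_cst0 hA); congr (_ - _).
apply: (tangent_germ hA); apply: (germ_slit hA) => // v sv.
by apply: (rho_eq_base hA); rewrite /betaf !rho_beta.
Qed.

(** * Uniqueness of the vertical part for conformal fibre metrics *)

Section two_metrics.
Variables g g' : forall u : TM A, tangent A (base u) -> tangent A (base u) -> R.
Variables (D D' : connection A) (s : M -> R).
Hypotheses (cD : is_connection D) (cD' : is_connection D').
Hypotheses (rD : regular D) (rD' : regular D').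
Hypothesis g_linearl : forall u k v v' w, slit u ->
  g (u := u) (k *: v + v') w = k * g v w + g v' w.
Hypothesis g_linearr : forall u k v w w', slit u ->
  g (u := u) v (k *: w + w') = k * g v w + g v w'.
Hypothesis g_definite : forall u v, slit u -> v != 0 -> 0 < g (u := u) v v.
Hypothesis s_smooth : forall x, smooth_at A x s.
Hypothesis g_conformal : forall u v w, slit u ->
  g' (u := u) v w = expR (s (base u)) * g v w.
Hypothesis metricD : forall u w Y Z, slit u -> pi_smooth Y -> pi_smooth Z ->
  tfun w (fun v => g (Y v) (Z v)) = g (u := u) (D w Y) (Z u) + g (Y u) (D w Z).
Hypothesis metricD' : forall u w Y Z, slit u -> pi_smooth Y -> pi_smooth Z ->
  tfun w (fun v => g' (Y v) (Z v)) =
  g' (u := u) (D' w Y) (Z u) + g' (Y u) (D' w Z).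
Hypothesis torsion_symD : forall X Y Z u, pi_smooth X -> pi_smooth Y ->
  pi_smooth Z -> slit u ->
  g (torsionT D X Y u) (Z u) = g (torsionT D X Z u) (Y u).
Hypothesis torsion_symD' : forall X Y Z u, pi_smooth X -> pi_smooth Y ->
  pi_smooth Z -> slit u ->
  g' (torsionT D' X Y u) (Z u) = g' (torsionT D' X Z u) (Y u).

Definition conn_diff (X Y : pi_field A) : pi_field A :=
  fun u => D (gamma (X u)) Y - D' (gamma (X u)) Y.

(** Needed because [conn_diff X Y] is itself substituted for a section in the skewness and symmetry
    identities. *)
Lemma conn_diff_smooth (X Y : pi_field A) : pi_smooth X -> pi_smooth Y ->
  pi_smooth (conn_diff X Y).
Proof.
by move=> sX sY; apply: pi_smooth_sub; exact: cov_gammaf_smooth.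
Qed.

Lemma conn_diff_skew (X Y Z : pi_field A) u : pi_smooth X -> pi_smooth Y ->
  pi_smooth Z -> slit u ->
  g (conn_diff X Y u) (Z u) + g (Y u) (conn_diff X Z u) = 0.
Proof.
move=> sX sY sZ su.
have m1 := metricD (gamma (X u)) su sY sZ.
have m2 := metricD' (gamma (X u)) su sY sZ.
(* The conformal factor comes out of a vertical derivative, so after cancelling it the two metricity
   identities compute the same number. *)
have m3 : gamma (X u) (fun v => g' (Y v) (Z v)) =
    expR (s (base u)) * gamma (X u) (fun v => g (Y v) (Z v)).
  rewrite -(gamma_expR_mul hA _ _ (@s_smooth _)); apply: (tangent_germ hA).
  by apply: (germ_slit hA) => // v sv; exact: g_conformal.
have e0 : expR (s (base u)) != 0 by rewrite lt0r_neq0// expR_gt0.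
rewrite m3 m1 !g_conformal// -mulrDr in m2.
have m4 := mulfI e0 m2.
have e1 : conn_diff X Y u =
    (-1) *: D' (gamma (X u)) Y + D (gamma (X u)) Y.
  by rewrite scaleN1r addrC.
have e2 : conn_diff X Z u =
    (-1) *: D' (gamma (X u)) Z + D (gamma (X u)) Z.
  by rewrite scaleN1r addrC.
by rewrite e1 e2 g_linearl// g_linearr// !mulN1r addrACA -opprD m4 addNr.
Qed.

Lemma conn_diff_sym (X Y Z : pi_field A) u : pi_smooth X -> pi_smooth Y ->
  pi_smooth Z -> slit u ->
  g (conn_diff X Y u) (Z u) = g (conn_diff X Z u) (Y u).
Proof.
move=> sX sY sZ su.
have e0 : expR (s (base u)) != 0 by rewrite lt0r_neq0// expR_gt0.
(* The bracket terms of the two torsions agree by [rho_bracket_beta] and cancel, so the difference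
   of connections inherits the symmetry of [T]. *)
have dT V : pi_smooth V ->
    conn_diff X V u = (-1) *: torsionT D' X V u + torsionT D X V u.
  move=> sV; rewrite (torsionT_eq cD rD sX sV su).
  rewrite (torsionT_eq cD' rD' sX sV su) (rho_bracket_beta X V rD rD' su).
  by rewrite scaleN1r opprB addrC addrA subrK.
have t2 := torsion_symD' sX sY sZ su.
rewrite !g_conformal// in t2; have {}t2 := mulfI e0 t2.
by rewrite !dT// !g_linearl// t2 torsion_symD.
Qed.

Lemma conn_diff0 (X Y : pi_field A) u : pi_smooth X -> pi_smooth Y ->
  slit u -> D (gamma (X u)) Y = D' (gamma (X u)) Y.
Proof.
move=> sX sY su; have sAY := conn_diff_smooth sX sY.
have := conn_diff_skew sX sAY sY su.
rewrite -(conn_diff_sym sX sY sAY su) -mulr2n => /eqP.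
rewrite mulrn_eq0/= => AY0.
apply/eqP; rewrite -subr_eq0; apply/negP => /negP /(g_definite su).
by rewrite lt0r (eqP AY0) eqxx.
Qed.

End two_metrics.

Lemma cartan_vertical (L L' : TM A -> R) (D D' : connection A) :
  is_finsler L -> is_cartan L D -> is_cartan L' D' -> conformal L L' ->
  forall (X Y : pi_field A) u, pi_smooth X -> pi_smooth Y -> slit u ->
  D u (gamma (X u)) Y = D' u (gamma (X u)) Y.
Proof.
move=> fL cD cD' [s [ss _ sL]] X Y u.
(* The abstract factor is [expR (s (base u))]; the 2 of the conformal change is absorbed into
   [s]. *)
apply: (@conn_diff0 (@finsler_metric _ _ _ _ L) (@finsler_metric _ _ _ _ L')
  D D' (fun x => 2 * s x)).
- exact: cartan_connection cD.
- exact: cartan_connection cD'.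
- exact: cartan_regular cD.
- exact: cartan_regular cD'.
- move=> v k x x' w sv.
  exact: (finsler_metric_linearl hA _ _ _ _ (finsler_smooth fL sv)).
- move=> v k x x' w sv.
  exact: (finsler_metric_linearr hA _ _ _ _ (finsler_smooth fL sv)).
- exact: finsler_definite fL.
- move=> x i p dp pu; apply: Cinf_near1 (ss x i p dp pu) => k U oU Cs.
  have := Cn_mul oU (@Cn_cst R E R k U 2) Cs.
  by apply: Cn_ext.
- exact: sL.
- exact: cartan_metric cD.
- exact: cartan_metric cD'.
- exact: cartan_T cD.
- exact: cartan_T cD'.
Qed.

End connections.

(** * The bracket of vertical fields *)

Section second_order.
Context {R : realType}.
Implicit Types E F : normedModType R.

Lemma Cinf_near_sum E F (I : Type) (s : seq I) (f : I -> E -> F) a :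
  (forall i, Cinf_near (f i) a) -> Cinf_near (fun b => \sum_(i <- s) f i b) a.
Proof.
move=> Cf; elim: s => [|i s IH].
  apply: Cinf_near_ext (Cinf_near_cst (0 : F) a).
  by apply: nearW => b; rewrite big_nil.
have H : Cinf_near (fun b => f i b + \sum_(j <- s) f j b) a.
  by apply: Cinf_near2 (Cf i) IH => k U oU; exact: Cn_add.
apply: Cinf_near_ext H.
by apply: nearW => b; rewrite big_cons.
Qed.

Lemma derive_bigsum E (I : Type) (s : seq I) (h : I -> E -> R) a v :
  (forall i, derivable (h i) a v) ->
  is_derive a v (fun b => \sum_(i <- s) h i b) (\sum_(i <- s) 'D_v (h i) a).
Proof.
move=> dh; elim: s => [|i s IH].
  rewrite big_nil (_ : (fun b => _) = cst 0); first exact: is_derive_cst.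
  by apply/funext => b; rewrite big_nil.
rewrite big_cons (_ : (fun b => _) = h i + (fun b => \sum_(j <- s) h j b)).
  by apply: is_deriveD; exact: derivableP.
by apply/funext => b; rewrite big_cons.
Qed.

(** Product rule for a moving direction: in the frame, one term freezes [eta] at [p] and the other
    differentiates its coordinates. *)
Lemma derive_derive_along E (b : frame E) (g : E -> R) (eta : E -> E) p x :
  Cinf_near g p -> differentiable eta p ->
  'D_x (fun q => 'D_(eta q) g q) p =
  'D_x ('D_(eta p) g) p + 'D_('D_x eta p) g p.
Proof.
move=> [U [oU Up Cg]] de; have [dg Dg] := Cg 2.
pose l i := frame_coord b i; pose e i := frame_vec (f := b) i.
have dl i : differentiable (l i \o eta) p.
  apply: differentiable_comp => //; apply: linear_differentiable.
  exact: frame_coord_continuous.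
have dDe i : differentiable ('D_(e i) g) p.
  by have [dD _] := Dg (e i); exact: dD.
have E1 : \forall q \near p,
    'D_(eta q) g q = \sum_i ((l i \o eta) * 'D_(e i) g) q.
  by apply: near_open oU Up _ => q Uq; rewrite (derive_frame b _ (dg q Uq)).
have E2 : \forall q \near p,
    'D_(eta p) g q = \sum_i ((l i (eta p)) \*: 'D_(e i) g) q.
  by apply: near_open oU Up _ => q Uq; rewrite (derive_frame b _ (dg q Uq)).
rewrite (near_eq_derive _ E1) (near_eq_derive _ E2).
rewrite (derive_frame b _ (dg p Up)).
have D1 i : derivable ((l i \o eta) * 'D_(e i) g) p x.
  by apply: derivableM; exact: diff_derivable.
have D2 i : derivable ((l i (eta p)) \*: 'D_(e i) g) p x.
  by apply: derivableZ; exact: diff_derivable.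
rewrite (@derive_val _ _ _ _ _ _ _ (derive_bigsum (index_enum _) D1)).
rewrite (@derive_val _ _ _ _ _ _ _ (derive_bigsum (index_enum _) D2)).
rewrite -big_split/=; apply: eq_bigr => i _.
rewrite deriveM; [|exact: diff_derivable|exact: diff_derivable].
rewrite deriveZ; last exact: diff_derivable.
rewrite derive_linear_comp//; last exact: frame_coord_continuous.
by congr (_ + _); exact: mulrC.
Qed.

(** The coordinate formula for the Lie bracket: the second-order parts, with frozen directions,
    cancel by [deriveC]. *)
Lemma derive_commutator E (b : frame E) (g : E -> R) (xi eta : E -> E) p :
  Cinf_near g p -> differentiable xi p -> differentiable eta p ->
  'D_(xi p) (fun q => 'D_(eta q) g q) p -
  'D_(eta p) (fun q => 'D_(xi q) g q) p =
  'D_('D_(xi p) eta p - 'D_(eta p) xi p) g p.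
Proof.
move=> Cg dx de.
rewrite (derive_derive_along b _ Cg de) (derive_derive_along b _ Cg dx).
have [U [oU Up CgU]] := Cg.
rewrite (deriveC _ _ oU Up (CgU 2)).
have dg := Cinf_near_differentiable Cg.
rewrite opprD addrACA subrr add0r !(deriveE _ dg).
by rewrite linearB.
Qed.

Lemma near_mono E (p : E) (P Q : E -> Prop) : (forall q, P q -> Q q) ->
  (\forall q \near p, P q) -> \forall q \near p, Q q.
Proof. by move=> PQ; apply: filterS. Qed.

Lemma near_line E p (v : E) (P : E -> Prop) : (\forall q \near p, P q) ->
  \forall t \near (0 : R), P (p + t *: v).
Proof.
have : (fun t : R => p + t *: v) @ 0 --> p + 0 *: v.
  by apply: cvgD; [exact: cvg_cst|apply: cvgZr_tmp; exact: cvg_id].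
by rewrite scale0r addr0 => H /H.
Qed.

End second_order.

Section vertical_derivative.
Context {R : realType} {n : nat} {M : topologicalType} {A : atlas 'rV[R]_n M}.
Hypothesis hA : smooth_manifold A.
Local Notation E := 'rV[R]_n.
Local Notation tm := (tm_atlas A).
Local Notation vinc := (@inr0 R E E).

(* The derivative of Y along the fibre, in the direction X: the points
   u + t X u all lie over the same x, so Y (u + t X u) is a curve in T_x M. *)
Definition vder (X Y : pi_field A) : pi_field A := fun u =>
  tvec A (base u) (fun f => derive1 (fun t : R => Y (add_fibre (t *: X u)) f) 0).

(** Along a fibre the point of [M] is fixed, so evaluation on [f] is one fixed continuous linear
    form in the components, and it commutes with the derivative in [t]. *)
Lemma vder_par (X Y : pi_field A) i (p : E * E) (c : E) (eta : E * E -> E) :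
  dom A i p.1 -> tfun (X (par tm i p)) = coord_vec (A := A) i p.1 c ->
  (\forall q \near p, tfun (Y (par tm i q)) = coord_vec (A := A) i q.1 (eta q)) ->
  differentiable eta p ->
  tfun (vder X Y (par tm i p)) = coord_vec (A := A) i p.1 ('D_(vinc c) eta p).
Proof.
move=> dp Xc Ye de; apply: tvec_tangent.
- exact: coord_vec_tangent.
- move=> f sf; have df := Cinf_near_differentiable (sf i p.1 dp erefl).
  have cl := diff_continuous df.
  rewrite coord_vecE// deriveE// -derive_linear_comp//.
  rewrite -derive1_line !derive1E; apply: near_eq_derive.
  apply: filterS (near_line (vinc c) Ye) => t Yt /=.
  apply: etrans (congr1 (fun v => tfun (Y v) f) (par_add_fibre hA t dp Xc)) _.
  rewrite Yt /= scaler0 addr0 coord_vecE//.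
  by rewrite (deriveE _ df).
- by move=> f; exact: coord_vec_nonsmooth.
Qed.

Lemma vder_smooth (X Y : pi_field A) : pi_smooth X -> pi_smooth Y ->
  pi_smooth (vder X Y).
Proof.
move=> sX sY u su i p dp pu; have [xi Cx Hx] := sX u su i p dp pu.
have [eta Ce He] := sY u su i p dp pu.
have deta : \forall q \near p, differentiable eta q.
  by apply: filterS (Cinf_near_near Ce) => q /Cinf_near_differentiable.
exists (fun q => 'D_(vinc (xi q)) eta q); last first.
  near=> q; apply: vder_par.
  - by near: q; exact: (near_dom hA dp).
  - by near: q; exact: Hx.
  (* At [q], [vder_par] wants the coordinate expression of [Y] in a neighbourhood of [q], not only
     at [q]. *)
  - by near: q; exact: (near_join He).
  - by near: q; exact: deta.
(* [Cinf_near_derive_along] is about real-valued maps, so [eta] is split into its entries and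
   reassembled. *)
apply: (@Cinf_near_ext R (E * E)%type E (fun q => \sum_(k < n)
    (scale_by (delta_mx 0 k : E) \o
    (fun q => 'D_(vinc (xi q)) (entry k \o eta) q)) q) _ p).
  apply: (@near_mono R (E * E)%type p _ _ _ deta) => q deq.
  rewrite [RHS]rV_expand; apply: eq_bigr => k _.
  rewrite /= derive_linear_comp//; exact: entry_continuous.
apply: Cinf_near_sum => k.
have C1 : Cinf_near (vinc \o xi) p.
  by apply: Cinf_near1 Cx => l U oU; apply: Cn_linear_comp => //; exact: inr0_continuous.
have C2 : Cinf_near (entry k \o eta) p.
  by apply: Cinf_near1 Ce => l U oU; apply: Cn_linear_comp => //; exact: entry_continuous.
have C3 : Cinf_near id p.
  exists setT; split=> // [|l]; first exact: openT.
  by apply: (@Cn_linear R _ _ idfun) => a; exact: cvg_id.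
have C4 := Cinf_near_derive_along (prod_frame (rV_frame n) (rV_frame n)) C3 C1 C2.
apply: Cinf_near1 C4 => l U oU; apply: Cn_linear_comp => //.
exact: scale_by_continuous.
Unshelve. all: by end_near. Qed.

(** In a chart both fields have zero base component, and differentiating such components keeps it
    zero; [derive_commutator] then yields a vertical direction with the components of
    [vder X Y - vder Y X]. *)
Lemma bracket_gammaf (X Y : pi_field A) u F : pi_smooth X -> pi_smooth Y ->
  slit u -> smooth_at tm u F ->
  bracket (gammaf X) (gammaf Y) u F = gamma (vder X Y u - vder Y X u) F.
Proof.
move=> sX sY su; have [i [p [dp pu]]] := TM_chart hA u.
have [xi Cx Hx] := sX u su i p dp pu; have [eta Ce He] := sY u su i p dp pu.
case: _ / pu su => su sF.
have Cg := sF i p dp erefl; set g := F \o par tm i in Cg.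
have C1 : Cinf_near (vinc \o xi) p.
  by apply: Cinf_near1 Cx => l U oU; apply: Cn_linear_comp => //; exact: inr0_continuous.
have C2 : Cinf_near (vinc \o eta) p.
  by apply: Cinf_near1 Ce => l U oU; apply: Cn_linear_comp => //; exact: inr0_continuous.
have C3 : Cinf_near id p.
  exists setT; split=> // [|l]; first exact: openT.
  by apply: (@Cn_linear R _ _ idfun) => a; exact: cvg_id.
pose b := prod_frame (rV_frame n) (rV_frame n) : frame (E * E)%type.
(* Smoothness of the inner derivative is needed for the outer vector to act on it as a derivative
   instead of returning the default 0. *)
have inner (Z : pi_field A) (zeta : E * E -> E) :
    Cinf_near (vinc \o zeta) p ->
    (\forall q \near p, tfun (Z (par tm i q)) = coord_vec (A := A) i q.1 (zeta q)) ->
    (\forall q \near p, ((fun v => gammaf Z v F) \o par tm i) q =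
      'D_((vinc \o zeta) q) g q) /\
    smooth_at tm (par tm i p) (fun v => gammaf Z v F).
  move=> Cz Hz.
  have e : \forall q \near p, ((fun v => gammaf Z v F) \o par tm i) q =
      'D_((vinc \o zeta) q) g q.
    near=> q.
    have dq : dom A i q.1 by near: q; exact: (near_dom hA dp).
    have Zq : tfun (Z (par tm i q)) = coord_vec (A := A) i q.1 (zeta q).
      by near: q; exact: Hz.
    have sq : smooth_at tm (par tm i q) F.
      by near: q; exact: (tm_smooth_near hA dp sF).
    by rewrite /= /gammaf (gamma_par hA dq Zq) coord_vecE.
  split=> //; apply: (tm_smooth_chart hA dp).
  apply: Cinf_near_ext (Cinf_near_derive_along b C3 Cz Cg).
  by apply: filterS e => q ->.
have [eX sgX] := inner X xi C1 Hx; have [eY sgY] := inner Y eta C2 He.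
have Xp := nbhs_singleton Hx; have Yp := nbhs_singleton He.
have dxi := Cinf_near_differentiable Cx; have deta := Cinf_near_differentiable Ce.
rewrite /bracket {1 3}/gammaf (gamma_par hA dp Xp) (gamma_par hA dp Yp).
rewrite (coord_vecE _ sgX) (coord_vecE _ sgY).
rewrite (near_eq_derive _ eX) (near_eq_derive _ eY).
have -> := @derive_commutator R _ b g (vinc \o xi) (vinc \o eta) p Cg
  (Cinf_near_differentiable C1) (Cinf_near_differentiable C2).
have vd : tfun (vder X Y (par tm i p) - vder Y X (par tm i p)) =
    coord_vec (A := A) i p.1 ('D_(vinc (xi p)) eta p - 'D_(vinc (eta p)) xi p).
  have e1 := vder_par dp Xp He deta; have e2 := vder_par dp Yp Hx dxi.
  move: ('D_(_) eta p) ('D_(_) xi p) e1 e2 => a c e1 e2.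
  have -> : a - c = (-1) *: c + a by rewrite scaleN1r addrC.
  by apply/funext => f; rewrite coord_vec_linear// -e1 -e2 mulN1r addrC.
rewrite (gamma_par hA dp vd) (coord_vecE _ sF).
have ci := @inr0_continuous R E E.
rewrite (derive_linear_comp _ ci deta) (derive_linear_comp _ ci dxi).
by rewrite linearB.
Unshelve. all: by end_near. Qed.

Lemma bracketf_gammaf (X Y : pi_field A) u : pi_smooth X -> pi_smooth Y ->
  slit u ->
  bracketf (gammaf X) (gammaf Y) u = gamma (vder X Y u - vder Y X u).
Proof.
move=> sX sY su; apply: val_inj; apply: tvec_tangent.
- by have /asboolP := tfunP (gamma (vder X Y u - vder Y X u)).
- by move=> F sF; exact: bracket_gammaf.
- move: (gamma _); have [i [p [dp pu]]] := TM_chart hA u; case: _ / pu => w F nF.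
  have [c wc] := tangent_coord w dp.
  by apply: etrans (congr1 (fun t => t F) wc) _; exact: coord_vec_nonsmooth.
Qed.

End vertical_derivative.

(** * Transfer of the recurrence *)

Section v_curvatures.
Context {R : realType} {n : nat} {M : topologicalType} {A : atlas 'rV[R]_n M}.
Hypothesis hA : smooth_manifold A.

(** Every direction is now [gamma] of a smooth pi-field, the only kind of direction for which the
    two connections are compared. *)
Lemma v_curvature_eq (D : connection A) (X Y Z : pi_field A) u :
  pi_smooth X -> pi_smooth Y -> slit u ->
  v_curvature D X Y Z u =
  - D u (gamma (X u)) (cov D (gammaf Y) Z) + D u (gamma (Y u)) (cov D (gammaf X) Z)
  + D u (gamma (vder X Y u - vder Y X u)) Z.
Proof.
move=> sX sY su; rewrite /v_curvature /curvature.
by rewrite [X in _ + X = _]/cov (bracketf_gammaf hA).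
Qed.

Lemma v_curvature_smooth (D : connection A) (X Y Z : pi_field A) :
  is_connection D -> pi_smooth X -> pi_smooth Y -> pi_smooth Z ->
  pi_smooth (v_curvature D X Y Z).
Proof.
move=> cD sX sY sZ; have cs := cov_gammaf_smooth hA cD.
have sV : pi_smooth (fun u => vder X Y u - vder Y X u).
  by apply: (pi_smooth_sub hA); exact: (vder_smooth hA).
have h1 := pi_smooth_opp hA (cs _ _ sX (cs _ _ sY sZ)).
have h2 := cs _ _ sY (cs _ _ sX sZ).
apply: (pi_smooth_ext hA _ (pi_smooth_add hA (pi_smooth_add hA h1 h2) (cs _ _ sV sZ))).
by move=> u su; rewrite v_curvature_eq.
Qed.

Section agreeing_connections.
Variables (D D' : connection A).
Hypotheses (cD : is_connection D) (cD' : is_connection D').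
Hypothesis DD' : forall (X Y : pi_field A) u, pi_smooth X -> pi_smooth Y ->
  slit u -> D (gamma (X u)) Y = D' (gamma (X u)) Y.

(** Connection and arguments change together because, in iterated derivatives, the inner sections
    built from [D] and [D'] agree over nonzero vectors only. *)
Lemma cov_agree (X X' Y Y' : pi_field A) u : pi_smooth X' ->
  (forall v, slit v -> X v = X' v) -> pi_smooth Y -> pi_smooth Y' ->
  (forall v, slit v -> Y v = Y' v) -> slit u ->
  cov D (gammaf X) Y u = cov D' (gammaf X') Y' u.
Proof.
move=> sX' eX sY sY' eY su; transitivity (D (gamma (X' u)) Y).
  by rewrite -eX.
transitivity (D (gamma (X' u)) Y'); first exact: (conn_local hA cD).
exact: DD'.
Qed.

Lemma v_curvature_agree (X X' Y Y' Z Z' : pi_field A) u :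
  pi_smooth X -> pi_smooth X' -> (forall v, slit v -> X v = X' v) ->
  pi_smooth Y -> pi_smooth Y' -> (forall v, slit v -> Y v = Y' v) ->
  pi_smooth Z -> pi_smooth Z' -> (forall v, slit v -> Z v = Z' v) ->
  slit u -> v_curvature D X Y Z u = v_curvature D' X' Y' Z' u.
Proof.
move=> sX sX' eX sY sY' eY sZ sZ' eZ su.
have csD := cov_gammaf_smooth hA cD; have csD' := cov_gammaf_smooth hA cD'.
have eXY := cov_agree sY' eY sZ sZ' eZ; have eYX := cov_agree sX' eX sZ sZ' eZ.
have e1 := cov_agree sX' eX (csD _ _ sY sZ) (csD' _ _ sY' sZ') eXY su.
have e2 := cov_agree sY' eY (csD _ _ sX sZ) (csD' _ _ sX' sZ') eYX su.
have gX v : slit v -> gammaf X v = gammaf X' v by move=> sv; rewrite /gammaf eX.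
have gY v : slit v -> gammaf Y v = gammaf Y' v by move=> sv; rewrite /gammaf eY.
(* Inside a bracket each field is differentiated at [u], so agreement over nonzero vectors enters
   through germs. *)
have eB : bracketf (gammaf X) (gammaf Y) u = bracketf (gammaf X') (gammaf Y') u.
  apply: (congr1 (tvec (tm_atlas A) u)); apply/funext => F.
  rewrite /bracket (gX u su) (gY u su).
  have -> : gammaf X' u (fun v => gammaf Y v F) = gammaf X' u (fun v => gammaf Y' v F).
    by apply: (tangent_germ hA); apply: (germ_slit hA) su => v sv; rewrite gY.
  have -> // : gammaf Y' u (fun v => gammaf X v F) = gammaf Y' u (fun v => gammaf X' v F).
  by apply: (tangent_germ hA); apply: (germ_slit hA) su => v sv; rewrite gX.
have sW : pi_smooth (fun u => vder X' Y' u - vder Y' X' u).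
  by apply: (pi_smooth_sub hA); exact: (vder_smooth hA).
have e3 : cov D (bracketf (gammaf X) (gammaf Y)) Z u =
    cov D' (bracketf (gammaf X') (gammaf Y')) Z' u.
  rewrite /cov eB (bracketf_gammaf hA sX' sY' su).
  exact: (cov_agree sW (fun v _ => erefl) sZ sZ' eZ su).
by rewrite /v_curvature /curvature e1 e2 e3.
Qed.

Lemma cov_v_curvature_agree (X Y Z W : pi_field A) u :
  pi_smooth X -> pi_smooth Y -> pi_smooth Z -> pi_smooth W -> slit u ->
  cov_v_curvature D X Y Z W u = cov_v_curvature D' X Y Z W u.
Proof.
move=> sX sY sZ sW su.
have rfl (V : pi_field A) : forall v, slit v -> V v = V v by [].
have csD V sV := cov_gammaf_smooth hA cD (Y := V) sX sV.
have csD' V sV := cov_gammaf_smooth hA cD' (Y := V) sX sV.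
have e V (sV : pi_smooth V) v (sv : slit v) :=
  cov_agree sX (rfl X) sV sV (rfl V) sv.
have sS := v_curvature_smooth cD sY sZ sW.
have sS' := v_curvature_smooth cD' sY sZ sW.
have eS v sv := v_curvature_agree sY sY (rfl Y) sZ sZ (rfl Z) sW sW (rfl W)
  (u := v) sv.
have e0 := cov_agree sX (rfl X) sS sS' eS su.
have e1 := v_curvature_agree (csD _ sY) (csD' _ sY) (e _ sY) sZ sZ (rfl Z)
  sW sW (rfl W) su.
have e2 := v_curvature_agree sY sY (rfl Y) (csD _ sZ) (csD' _ sZ) (e _ sZ)
  sW sW (rfl W) su.
have e3 := v_curvature_agree sY sY (rfl Y) sZ sZ (rfl Z) (csD _ sW) (csD' _ sW)
  (e _ sW) su.
by rewrite /cov_v_curvature e0 e1 e2 e3.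
Qed.

Lemma Sv_recurrent_agree : Sv_recurrent D -> Sv_recurrent D'.
Proof.
move=> [lambda lform H]; exists lambda => // X Y Z W u sX sY sZ sW su.
rewrite -cov_v_curvature_agree// H//; congr (_ *: _).
exact: v_curvature_agree.
Qed.

End agreeing_connections.
End v_curvatures.

Theorem proposition3p28 (R : realType) (n : nat) (M : topologicalType)
    (A : atlas 'rV[R]_n M) (L L' : TM A -> R) (D D' : connection A) :
  smooth_manifold A ->
  is_finsler L -> is_finsler L' ->
  is_cartan L D -> is_cartan L' D' ->
  conformal L L' ->
  (Sv_recurrent D <-> Sv_recurrent D').
Proof.
move=> hA fL _ cD cD' conf; have agree := cartan_vertical hA fL cD cD' conf.
have cn := cartan_connection cD; have cn' := cartan_connection cD'.
(* Vertical agreement is an equation between the connections, so the converse follows by exchanging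
   them, without inverting the conformal change. *)
split; [apply: (Sv_recurrent_agree hA cn cn')|apply: (Sv_recurrent_agree hA cn' cn)].
  exact: agree.
by move=> X Y u sX sY su; exact: (esym (agree X Y u sX sY su)).
Qed.
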